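(* Let $T$ be the tree generated by a test and let $\xi<\omega_1$. Then the set $[T]\setminus S_{1+\xi}$ is in $\mathbf{\Pi}^0_{1+\xi}(2^\omega\times 2^\omega)$ but is not $\mathrm{pot}(\mathbf{\Sigma}^0_{1+\xi})$, and $S_{1+\xi}$ is not $\mathrm{pot}(\mathbf{\Pi}^0_{1+\xi})$.
   Context: Let $\langle n,p\rangle:=\left(\sum_{k\leq n+p}k\right)+p$ (a bijection $\omega^2\to\omega$), with inverse $q\mapsto((q)_0,(q)_1)$. A set $E\subseteq\bigcup_{q}2^q\times 2^q$ is a test if: (a) for each $q$ there is a unique $(s_q,t_q)\in E\cap(2^q\times 2^q)$; (b) for all $m,p\in\omega$ and $u\in 2^{<\omega}$ there is $v\in 2^{<\omega}$ with $(s_p0uv,t_p1uv)\in E$ and $(|t_p1uv|-1)_0=m$; (c) for each $n>0$ there are $q<n$ and $w$ with $s_n=s_q0w$, $t_n=t_q1w$. The tree generated by $E$ is $T:=\{(s,t): s=t=\emptyset$ or $\exists q\,\exists w\ (s,t)=(s_q0w,t_q1w)\}$; $[T]$ is its set of infinite branches in $2^\omega\times 2^\omega$. Define $\rho_0:2^\omega\to 2^\omega$ by $\rho_0(\varepsilon)(i)=1$ iff $\varepsilon(\langle i,j\rangle)=0$ for all $j$. Define $\rho_0^\xi$ for $\xi<\omega_1$: $\rho_0^0=\mathrm{Id}$, $\rho_0^{\eta+1}=\rho_0\circ\rho_0^\eta$; for limit $\lambda>0$ fix ordinals $(\xi^\lambda_k)_k\subseteq\lambda\setminus\{0\}$ with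 $\sum_k\xi^\lambda_k=\lambda$, let $(\varepsilon)^k(i):=\varepsilon(i+k)$, define $\rho_0^{(k,k+1)}(\varepsilon)(i):=\varepsilon(i)$ for $i<k$ and $:=\rho_0^{\xi^\lambda_k}((\varepsilon)^k)(i-k)$ for $i\geq k$, let $\rho_0^{(0,k+1)}:=\rho_0^{(k,k+1)}\circ\dots\circ\rho_0^{(0,1)}$, and $\rho_0^\lambda(\varepsilon)(k):=\rho_0^{(0,k+1)}(\varepsilon)(k)$. Put $H_{1+\xi}:=(\rho_0^\xi)^{-1}(\{0^\infty\})$. Let $\mathcal S:2^\omega\to 2^\omega$ be the shift $\mathcal S(\alpha)(m)=\alpha(m+1)$ and $\alpha\,\Delta\,\beta$ the symmetric difference ($(\alpha\Delta\beta)(m)=1$ iff $\alpha(m)\neq\beta(m)$). Set $S_{1+\xi}:=\{(\alpha,\beta)\in[T]:\mathcal S(\alpha\,\Delta\,\beta)\notin H_{1+\xi}\}$. A Borel set $A\subseteq X\times Y$ is $\mathrm{pot}(\Gamma)$ if there are finer Polish topologies $\sigma$ on $X$, $\tau$ on $Y$ with $A\in\Gamma([X,\sigma]\times[Y,\tau])$. *)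

(* Defs.v *)
From Stdlib Require Import Reals List Arith ClassicalDescription.
Import ListNotations.
Open Scope R_scope.

(* ---------- Countable ordinals (xi < omega_1) as Brouwer trees ---------- *)
Inductive ord : Type :=
| OZ : ord
| OS : ord -> ord
| OL : (nat -> ord) -> ord.   (* OL f = sup_n f n *)

(* the (standard) order on Brouwer trees; ole x y  <->  |x| <= |y| *)
Inductive ole : ord -> ord -> Prop :=
| ole_zero x : ole OZ x
| ole_trans x y z : ole x y -> ole y z -> ole x z
| ole_succ x y : ole x y -> ole (OS x) (OS y)
| ole_cocone x f k : ole x (f k) -> ole x (OL f)
| ole_limiting f x : (forall k, ole (f k) x) -> ole (OL f) x.

Definition olt (x y : ord) : Prop := ole (OS x) y.
Definition oeq (x y : ord) : Prop := ole x y /\ ole y x.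

Definition is_limit (l : ord) : Prop :=
  ~ ole l OZ /\ forall e, ~ oeq l (OS e).

Fixpoint oadd (a b : ord) : ord :=
  match b with
  | OZ => a
  | OS b' => OS (oadd a b')
  | OL f => OL (fun n => oadd a (f n))
  end.

Fixpoint opartial (x : nat -> ord) (n : nat) : ord :=
  match n with
  | O => x O
  | S m => oadd (opartial x m) (x (S m))
  end.

Definition osum (x : nat -> ord) : ord := OL (opartial x).

(* the fixed sequences (xi^lambda_k)_k for limit lambda, chosen per ordinal *)
Definition good_sel (sel : ord -> nat -> ord) : Prop :=
  (forall l l', oeq l l' -> forall k, oeq (sel l k) (sel l' k)) /\
  (forall l, is_limit l ->
     (forall k, ~ ole (sel l k) OZ /\ olt (sel l k) l) /\ oeq (osum (sel l)) l).

Definition cantor := nat -> bool.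

Fixpoint sum_upto (m : nat) : nat :=
  match m with O => O | S m' => (m + sum_upto m')%nat end.
Definition pairing (n p : nat) : nat := (sum_upto (n + p) + p)%nat.

Definition rho0 (eps : cantor) : cantor := fun i =>
  if excluded_middle_informative (forall j, eps (pairing i j) = false)
  then true else false.

Definition rho_step (R : ord -> cantor -> cantor) (sel : ord -> nat -> ord)
  (l : ord) (k : nat) (eps : cantor) : cantor := fun i =>
  if Nat.ltb i k then eps i
  else R (sel l k) (fun j => eps (j + k)%nat) (i - k)%nat.

Fixpoint rho_upto (R : ord -> cantor -> cantor) (sel : ord -> nat -> ord)
  (l : ord) (k : nat) (eps : cantor) : cantor :=
  match k with
  | O => eps
  | S k' => rho_step R sel l k' (rho_upto R sel l k' eps)
  end.

Definition rho_lim (R : ord -> cantor -> cantor) (sel : ord -> nat -> ord)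
  (l : ord) (eps : cantor) : cantor := fun k => rho_upto R sel l (S k) eps k.

Definition rho_family (sel : ord -> nat -> ord) (R : ord -> cantor -> cantor) : Prop :=
  (forall x y, oeq x y -> forall eps, R x eps = R y eps) /\
  (forall x, oeq x OZ -> forall eps, R x eps = eps) /\
  (forall x e, oeq x (OS e) -> forall eps, R x eps = rho0 (R e eps)) /\
  (forall l, is_limit l -> forall eps, R l eps = rho_lim R sel l eps).

Definition H_set (R : ord -> cantor -> cantor) (xi : ord) (eps : cantor) : Prop :=
  forall i, R xi eps i = false.

Definition shift (a : cantor) : cantor := fun m => a (S m).
Definition symdiff (a b : cantor) : cantor := fun m => negb (Bool.eqb (a m) (b m)).

Definition is_test (E : list bool -> list bool -> Prop) : Prop :=
  (forall s t, E s t -> length s = length t) /\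
  (forall q, exists s t, length s = q /\ E s t /\
     forall s' t', length s' = q -> E s' t' -> s' = s /\ t' = t) /\
  (forall (m p : nat) (u : list bool) s t, E s t -> length s = p ->
     exists v, E (s ++ false :: u ++ v) (t ++ true :: u ++ v) /\
       exists j, pairing m j = (length (t ++ true :: u ++ v) - 1)%nat) /\
  (forall n s t, (0 < n)%nat -> E s t -> length s = n ->
     exists q s' t' w, (q < n)%nat /\ E s' t' /\ length s' = q /\
       s = s' ++ false :: w /\ t = t' ++ true :: w).

Definition in_tree (E : list bool -> list bool -> Prop) (s t : list bool) : Prop :=
  (s = [] /\ t = []) \/
  exists s' t' w, E s' t' /\ s = s' ++ false :: w /\ t = t' ++ true :: w.

Definition pref (a : cantor) (n : nat) : list bool := map a (seq 0 n).

Definition body (E : list bool -> list bool -> Prop) (z : cantor * cantor) : Prop :=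
  forall n, in_tree E (pref (fst z) n) (pref (snd z) n).

Definition S_set (E : list bool -> list bool -> Prop) (R : ord -> cantor -> cantor)
  (xi : ord) (z : cantor * cantor) : Prop :=
  body E z /\ ~ H_set R xi (shift (symdiff (fst z) (snd z))).

(* a topology is given by its collection of open sets *)
Definition cantor_open (U : cantor -> Prop) : Prop :=
  forall x, U x -> exists n, forall y, (forall i, (i < n)%nat -> y i = x i) -> U y.

Definition prod_open {X Y : Type} (sig : (X -> Prop) -> Prop) (tau : (Y -> Prop) -> Prop)
  (W : X * Y -> Prop) : Prop :=
  forall x y, W (x, y) -> exists U V, sig U /\ tau V /\ U x /\ V y /\
    forall x' y', U x' -> V y' -> W (x', y').

(* Borel classes: Sigma0 op xi A  <->  A in Sigma^0_{1+xi} of the topology op *)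
Inductive Sigma0 {Z : Type} (op : (Z -> Prop) -> Prop) : ord -> (Z -> Prop) -> Prop :=
| Sig_open xi A : ole xi OZ -> op A -> Sigma0 op xi A
| Sig_union xi (eta : nat -> ord) (An : nat -> Z -> Prop) (A : Z -> Prop) :
    ~ ole xi OZ -> (forall n, olt (eta n) xi) ->
    (forall n, Sigma0 op (eta n) (fun z => ~ An n z)) ->
    (forall z, A z <-> exists n, An n z) -> Sigma0 op xi A.

Definition Pi0 {Z : Type} (op : (Z -> Prop) -> Prop) (xi : ord) (A : Z -> Prop) : Prop :=
  Sigma0 op xi (fun z => ~ A z).

Definition Polish {X : Type} (op : (X -> Prop) -> Prop) : Prop :=
  exists d : X -> X -> R,
    (forall x y, 0 <= d x y) /\ (forall x y, d x y = 0 <-> x = y) /\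
    (forall x y, d x y = d y x) /\ (forall x y z, d x z <= d x y + d y z) /\
    (forall U, op U <-> forall x, U x -> exists e, 0 < e /\ forall y, d x y < e -> U y) /\
    (forall u : nat -> X,
       (forall e, 0 < e -> exists N, forall n m, (N <= n)%nat -> (N <= m)%nat -> d (u n) (u m) < e) ->
       exists l, forall e, 0 < e -> exists N, forall n, (N <= n)%nat -> d (u n) l < e) /\
    (exists s : nat -> X, forall x e, 0 < e -> exists n, d x (s n) < e).

Definition finer_polish (op : (cantor -> Prop) -> Prop) : Prop :=
  (forall U, cantor_open U -> op U) /\ Polish op.

Definition pot_Sigma0 (xi : ord) (A : cantor * cantor -> Prop) : Prop :=
  exists sig tau, finer_polish sig /\ finer_polish tau /\ Sigma0 (prod_open sig tau) xi A.

Definition pot_Pi0 (xi : ord) (A : cantor * cantor -> Prop) : Prop :=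
  exists sig tau, finer_polish sig /\ finer_polish tau /\ Pi0 (prod_open sig tau) xi A.

(* Main.v *)
(** Fix a finer Polish topology [tau] on the second factor.  A fusion argument
    using only Baire category produces one point [a0] and a [tau]-continuous [f]
    with all [(a0, f a)] in the body of the tree, such that
    [b = shift (symdiff a0 (f a))] has a [1] in exactly the same columns
    [{pairing m j | j}] as [a].  Since [rho0^xi] with [xi > 0] sees only which
    columns are empty, [a] is in [H] iff [b] is; restricting to the vertical section
    at [a0], it thus suffices that [H] is [Pi^0_{1+xi}] but not
    [Sigma^0_{1+xi}].  For the latter, every [Pi^0_{1+xi}] set reduces to [H]
    by a map [g] such that [g a n] depends only on [a 0, ..., a (n-1)]; applied to
    the complement of [H], such a [g] would have a fixed point, which is absurd. *)

From Stdlib Require Import Reals List Arith ClassicalDescription.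
From Stdlib Require Import Classical FunctionalExtensionality PropExtensionality.
From Stdlib Require Import IndefiniteDescription Lia Lra Cantor.
Require Import Defs.
Import ListNotations.
Open Scope nat_scope.

(** * Brouwer ordinals *)

(** Category links the usual topology to [tau]. A nonmeager set is covered by countably many small
    balls of a separable metric for [tau], so one of the pieces is nonmeager, and then nonmeager
    everywhere below some cylinder. Words can therefore still be extended at will while such a piece
    confines the [tau]-limit. All branches receive the same extension at each stage, which keeps the
    first coordinate single; the clause of the test that prescribes a column serves one branch at a
    time, the one that splits.

    On the other side, [g] is a strategy in a Wadge-type game that moves before its opponent. The
    induction on [xi] asks for a strategy at each single coordinate of the map; different
    coordinates read disjoint sets of places, so the strategies can be played together. Moving first
    has a price: a clopen set is known only after finitely many moves, so for the identity only late
    coordinates can be won. This is the origin of the thresholds [N] in the induction. *)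

Lemma ole_refl x : ole x x.
Proof.
  induction x as [|x IH|f IH].
  - apply ole_zero.
  - now apply ole_succ.
  - apply ole_limiting; intro k. now apply ole_cocone with k.
Qed.

(* [ole] has transitivity as a constructor, so it is inverted through this
   structurally recursive version. *)
Fixpoint rle (x : ord) : ord -> Prop :=
  match x with
  | OZ => fun _ => True
  | OS x' => fix rlt (y : ord) : Prop :=
      match y with
      | OZ => False
      | OS y' => rle x' y'
      | OL g => exists k, rlt (g k)
      end
  | OL f => fun y => forall k, rle (f k) y
  end.

Lemma rle_cocone x f k : rle x (f k) -> rle x (OL f).
Proof.
  revert f k; induction x as [|x IH|h IH]; intros f k H; simpl in *; auto.
  - now exists k.
  - intro j. now apply IH with k.
Qed.

Lemma rle_trans y : forall x z, rle x y -> rle y z -> rle x z.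
Proof.
  induction y as [|y IH|f IH]; intros x z Hxy Hyz;
    (induction x as [|x IHx|h IHx]; [exact I| |intro k; now apply IHx]).
  - contradiction.
  - clear IHx. simpl in Hxy. induction z as [|z _|g IHg].
    + contradiction.
    + exact (IH x z Hxy Hyz).
    + destruct Hyz as [k Hk]. exists k. now apply IHg.
  - destruct Hxy as [k Hk]. now apply (IH k).
Qed.

Lemma ole_rle x y : ole x y -> rle x y.
Proof.
  induction 1; simpl; auto.
  - now apply rle_trans with y.
  - now apply rle_cocone with k.
Qed.

Lemma rle_ole x : forall y, rle x y -> ole x y.
Proof.
  induction x as [|x IH|f IH]; intros y H.
  - apply ole_zero.
  - induction y as [|y _|g IHg]; simpl in H.
    + contradiction.
    + now apply ole_succ, IH.
    + destruct H as [k Hk]. apply ole_cocone with k. now apply IHg.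
  - apply ole_limiting; intro k. now apply IH.
Qed.

Lemma ole_OS_inv x y : ole (OS x) (OS y) -> ole x y.
Proof. intro H. apply rle_ole. exact (ole_rle _ _ H). Qed.

Lemma not_OS_OZ x : ~ ole (OS x) OZ.
Proof. intro H. exact (ole_rle _ _ H). Qed.

Lemma ole_OS_OL x g : ole (OS x) (OL g) -> exists k, ole (OS x) (g k).
Proof.
  intro H. destruct (ole_rle _ _ H) as [k Hk]. exists k. now apply rle_ole.
Qed.

Lemma ole_OS_r x : ole x (OS x).
Proof.
  induction x as [|x IH|f IH].
  - apply ole_zero.
  - now apply ole_succ.
  - apply ole_limiting; intro k. apply ole_trans with (OS (f k)); auto.
    apply ole_succ, ole_cocone with k, ole_refl.
Qed.

Lemma olt_ole x y : olt x y -> ole x y.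
Proof. apply ole_trans, ole_OS_r. Qed.

(** Trees of the same rank may be different terms, so the structural induction carries all [z] with
    [ole z x], not only the subtrees of [x]. *)
Lemma olt_ind (P : ord -> Prop) :
  (forall x, (forall y, olt y x -> P y) -> P x) -> forall x, P x.
Proof.
  intros step x.
  enough (H : forall z, ole z x -> P z) by apply H, ole_refl.
  induction x as [|x IH|f IH]; intros z Hz; apply step; intros y Hy;
    pose proof (ole_trans _ _ _ Hy Hz) as Hy'.
  - now apply not_OS_OZ in Hy'.
  - now apply IH, ole_OS_inv.
  - apply ole_OS_OL in Hy' as [k Hk]. apply (IH k). now apply olt_ole.
Qed.

Lemma ole_or_olt x : forall y, ole x y \/ olt y x.
Proof.
  induction x as [|x IH|f IH]; intro y.
  - left; apply ole_zero.
  - induction y as [|y _|g IHg].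
    + right. apply ole_succ, ole_zero.
    + destruct (IH y) as [H|H]; [left|right]; now apply ole_succ.
    + destruct (classic (exists k, ole (OS x) (g k))) as [[k Hk]|N].
      * left. now apply ole_cocone with k.
      * right. apply ole_succ, ole_limiting; intro k.
        destruct (IHg k) as [H|H]; [exfalso; eauto|]. now apply ole_OS_inv.
  - destruct (classic (forall k, ole (f k) y)) as [H|N].
    + left. now apply ole_limiting.
    + right. apply not_all_ex_not in N as [k Hk].
      destruct (IH k y) as [H|H]; [contradiction|]. now apply ole_cocone with k.
Qed.

Lemma olt_OZ x : ~ ole x OZ -> olt OZ x.
Proof. intro N. destruct (ole_or_olt x OZ); [contradiction|assumption]. Qed.

Lemma olt_not_OZ x y : olt x y -> ~ ole y OZ.
Proof. intros H H'. exact (not_OS_OZ _ (ole_trans _ _ _ H H')). Qed.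

Lemma ole_oadd_l a b : ole a (oadd a b).
Proof.
  induction b as [|b IH|f IH]; simpl.
  - apply ole_refl.
  - apply ole_trans with (1 := IH), ole_OS_r.
  - apply ole_cocone with 0; auto.
Qed.

Lemma ole_oadd_r a b : ole b (oadd a b).
Proof.
  induction b as [|b IH|f IH]; simpl.
  - apply ole_zero.
  - now apply ole_succ.
  - apply ole_limiting; intro k. now apply ole_cocone with k.
Qed.

Lemma oadd_mono a b c : ole b c -> ole (oadd a b) (oadd a c).
Proof.
  induction 1; simpl.
  - apply ole_oadd_l.
  - eapply ole_trans; eauto.
  - now apply ole_succ.
  - now apply ole_cocone with k.
  - now apply ole_limiting.
Qed.

Lemma oadd_OZ_l a : oadd OZ a = a.
Proof.
  induction a as [|a IH|f IH]; simpl; f_equal; auto.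
  now apply functional_extensionality.
Qed.

Lemma oadd_assoc a b c : oadd (oadd a b) c = oadd a (oadd b c).
Proof.
  induction c as [|c IH|f IH]; simpl; f_equal; auto.
  now apply functional_extensionality.
Qed.

Lemma ord_cases x : oeq x OZ \/ (exists e, oeq x (OS e)) \/ is_limit x.
Proof.
  destruct (classic (ole x OZ)) as [H|H].
  - left. split; [assumption|apply ole_zero].
  - right. destruct (classic (exists e, oeq x (OS e))) as [He|He]; auto.
    right. split; auto. intros e H'. eauto.
Qed.

Lemma oeq_OS_olt x e : oeq x (OS e) -> olt e x.
Proof. now intros []. Qed.

(** * Pairing and finite sequences *)

Lemma pairing_to_nat n p : pairing n p = to_nat (n, p).
Proof.
  assert (H : forall m, sum_upto m = nat_rec (fun _ => nat) 0 (fun i r => S i + r) m).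
  { induction m as [|m IH]; [reflexivity|]. simpl. now rewrite IH. }
  unfold pairing, to_nat. rewrite H, (Nat.add_comm n p), Nat.add_comm. reflexivity.
Qed.

Definition unl (q : nat) := fst (of_nat q).
Definition unr (q : nat) := snd (of_nat q).

Lemma unl_pairing n p : unl (pairing n p) = n.
Proof. unfold unl. now rewrite pairing_to_nat, cancel_of_to. Qed.

Lemma unr_pairing n p : unr (pairing n p) = p.
Proof. unfold unr. now rewrite pairing_to_nat, cancel_of_to. Qed.

Lemma pairing_un q : pairing (unl q) (unr q) = q.
Proof.
  unfold unl, unr. now rewrite pairing_to_nat, <- surjective_pairing, cancel_to_of.
Qed.

Lemma pairing_ge_r n p : p <= pairing n p.
Proof. unfold pairing. lia. Qed.

Lemma unl_le q : unl q <= q.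
Proof.
  rewrite <- (pairing_un q) at 2. unfold pairing.
  assert (H : forall m, m <= sum_upto m) by (induction m; simpl; lia).
  specialize (H (unl q + unr q)). lia.
Qed.

(** The binary digits below the leading one, lowest first, so that every finite word occurs. *)
Fixpoint word_of_pos (p : positive) : list bool :=
  match p with
  | xH => []
  | xO p => false :: word_of_pos p
  | xI p => true :: word_of_pos p
  end.

Definition word (n : nat) : list bool := word_of_pos (Pos.of_succ_nat n).

Lemma word_surj s : exists n, word n = s.
Proof.
  assert (H : exists p, word_of_pos p = s).
  { induction s as [|b s [p Hp]].
    - now exists xH.
    - destruct b; [exists (xI p)|exists (xO p)]; simpl; now rewrite Hp. }
  destruct H as [p Hp]. exists (pred (Pos.to_nat p)). unfold word.
  rewrite <- Hp. f_equal.
  apply Pos2Nat.inj. rewrite SuccNat2Pos.id_succ.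
  pose proof (Pos2Nat.is_pos p). lia.
Qed.

Lemma pref_length a n : length (pref a n) = n.
Proof. unfold pref. now rewrite length_map, length_seq. Qed.

Lemma pref_nth a n i : i < n -> nth i (pref a n) false = a i.
Proof.
  intro H. unfold pref.
  rewrite nth_indep with (d' := a 0) by (now rewrite length_map, length_seq).
  rewrite map_nth, seq_nth; auto.
Qed.

Definition cyl (s : list bool) (y : cantor) : Prop :=
  forall i, i < length s -> y i = nth i s false.

Lemma cyl_app s x y : cyl (s ++ x) y -> cyl s y.
Proof.
  intros H i Hi. rewrite H by (rewrite length_app; lia). now apply app_nth1.
Qed.

Lemma cyl_pref a n y : cyl (pref a n) y <-> forall i, i < n -> y i = a i.
Proof.
  unfold cyl. rewrite pref_length.
  split; intros H i Hi; rewrite H by assumption; rewrite pref_nth; auto.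
Qed.

Lemma cyl_firstn s y n : n <= length s -> cyl s y -> pref y n = firstn n s.
Proof.
  intros Hn H. apply nth_ext with false false; rewrite pref_length.
  - rewrite length_firstn. lia.
  - intros i Hi. rewrite pref_nth, nth_firstn by assumption.
    destruct (Nat.ltb_spec i n); [apply H|]; lia.
Qed.

Lemma cyl_unique s y : cyl s y -> pref y (length s) = s.
Proof.
  intro H. rewrite (cyl_firstn s) by auto. apply firstn_all.
Qed.

(** * Borel classes *)

Lemma set_ext {Z : Type} (A B : Z -> Prop) : (forall z, A z <-> B z) -> A = B.
Proof.
  intro H. apply functional_extensionality; intro z.
  now apply propositional_extensionality.
Qed.

Lemma set_notnot {Z : Type} (A : Z -> Prop) : (fun z => ~ ~ A z) = A.
Proof. apply set_ext; intro z. split; [apply NNPP|tauto]. Qed.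

Lemma NNPP_iff (P : Prop) : ~ ~ P <-> P.
Proof. split; [apply NNPP|tauto]. Qed.

Lemma Sigma0_ext {Z} (op : (Z -> Prop) -> Prop) xi A B :
  (forall z, A z <-> B z) -> Sigma0 op xi A -> Sigma0 op xi B.
Proof. intros H. now rewrite (set_ext A B H). Qed.

Lemma Sigma0_preimage {Z W} (opZ : (Z -> Prop) -> Prop) (opW : (W -> Prop) -> Prop)
  (f : Z -> W) xi A :
  (forall U, opW U -> opZ (fun z => U (f z))) ->
  Sigma0 opW xi A -> Sigma0 opZ xi (fun z => A (f z)).
Proof.
  intros Hf H. induction H as [xi A H0 HA|xi eta An A H0 Hlt HS IH HA].
  - apply Sig_open; auto.
  - apply Sig_union with eta (fun n z => An n (f z)); auto.
Qed.

Lemma open_union (U : nat -> cantor -> Prop) :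
  (forall n, cantor_open (U n)) -> cantor_open (fun x => exists n, U n x).
Proof.
  intros H x [n Hn]. destruct (H n x Hn) as [k Hk]. exists k. eauto.
Qed.

Lemma open_inter U V :
  cantor_open U -> cantor_open V -> cantor_open (fun x => U x /\ V x).
Proof.
  intros HU HV x [Hx Hx'].
  destruct (HU x Hx) as [n Hn], (HV x Hx') as [m Hm].
  exists (Nat.max n m). intros y Hy. split; [apply Hn|apply Hm]; intros; apply Hy; lia.
Qed.

(* By compactness these are exactly the clopen sets. *)
Definition clopen (C : cantor -> Prop) : Prop :=
  exists n, forall x y, (forall i, i < n -> x i = y i) -> C x -> C y.

Lemma clopen_open C : clopen C -> cantor_open C.
Proof.
  intros [n Hn] x Hx. exists n. intros y Hy. apply Hn with x; auto.
  intros; symmetry; auto.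
Qed.

Lemma clopen_ext C D : (forall x, C x <-> D x) -> clopen C -> clopen D.
Proof. intros H. now rewrite (set_ext C D H). Qed.

Lemma clopen_cyl s : clopen (cyl s).
Proof.
  exists (length s). intros x y H Hx i Hi. rewrite <- H; auto.
Qed.

Lemma clopen_const (P : Prop) : clopen (fun _ => P).
Proof. exists 0. auto. Qed.

Lemma clopen_not C : clopen C -> clopen (fun x => ~ C x).
Proof.
  intros [n Hn]. exists n. intros x y H Hx Hy. apply Hx, Hn with y; auto.
  intros; symmetry; auto.
Qed.

Lemma open_cyls U : cantor_open U ->
  exists C : nat -> cantor -> Prop, (forall n, clopen (C n)) /\
    forall x, U x <-> exists n, C n x.
Proof.
  intro H.
  (* The second conjunct does not depend on [x]: each of these sets is a whole cylinder or empty. *)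
  exists (fun n x => cyl (word n) x /\ forall y, cyl (word n) y -> U y). split.
  - intro n. destruct (classic (forall y, cyl (word n) y -> U y)) as [Hn|Hn].
    + apply clopen_ext with (cyl (word n)); [tauto|apply clopen_cyl].
    + apply clopen_ext with (fun _ => False); [tauto|apply clopen_const].
  - intro x. split.
    + intro Hx. destruct (H x Hx) as [n Hn].
      destruct (word_surj (pref x n)) as [k Hk]. exists k. rewrite Hk. split.
      * now apply cyl_pref.
      * intros y Hy. apply Hn. now apply cyl_pref.
    + intros [n [Hn Hn']]. auto.
Qed.

Notation Sig := (Sigma0 cantor_open).

Lemma clopen_Sigma0 xi C : clopen C -> Sig xi C.
Proof.
  intro HC. destruct (classic (ole xi OZ)) as [H|H].
  - now apply Sig_open, clopen_open.
  - apply Sig_union with (fun _ => OZ) (fun _ => C); auto.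
    + intros _. now apply olt_OZ.
    + intros _. now apply Sig_open, clopen_open, clopen_not; [apply ole_refl|].
    + intro z. split; [now exists 0|now intros []].
Qed.

Lemma Sigma0_union_of_Pi0 xi (eta : nat -> ord) (A : nat -> cantor -> Prop) :
  ~ ole xi OZ -> (forall n, olt (eta n) xi) -> (forall n, Pi0 cantor_open (eta n) (A n)) ->
  Sig xi (fun x => exists n, A n x).
Proof. intros H0 Hlt HA. apply Sig_union with eta A; auto. tauto. Qed.

Lemma Pi0_Sigma0 eta xi A : olt eta xi -> Pi0 cantor_open eta A -> Sig xi A.
Proof.
  intros H HA. apply Sigma0_ext with (fun x => exists n : nat, A x).
  - intro z. split; [now intros []|now exists 0].
  - apply Sigma0_union_of_Pi0 with (fun _ => eta); auto. now apply olt_not_OZ with eta.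
Qed.

(** Only open sets need work: they are countable unions of clopen sets, whose complements are again
    open. *)
Lemma Sigma0_mono xi xi' A : ole xi xi' -> Sig xi A -> Sig xi' A.
Proof.
  intros Hle H. destruct H as [xi A H0 HA|xi eta An A H0 Hlt HS HA].
  - destruct (classic (ole xi' OZ)) as [H|H]; [now apply Sig_open|].
    destruct (open_cyls A HA) as [C [HC HAC]].
    apply Sig_union with (fun _ => OZ) C; auto.
    + intros _. now apply olt_OZ.
    + intro n. now apply clopen_Sigma0, clopen_not.
  - apply Sig_union with eta An; auto.
    + intro H. apply H0. now apply ole_trans with xi'.
    + intro n. now apply ole_trans with (1 := Hlt n).
Qed.

Lemma Sigma0_inv xi A : ~ ole xi OZ -> Sig xi A ->
  exists (eta : nat -> ord) (An : nat -> cantor -> Prop),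
    (forall n, olt (eta n) xi) /\ (forall n, Pi0 cantor_open (eta n) (An n)) /\
    forall x, A x <-> exists n, An n x.
Proof.
  intros H0 H. destruct H as [xi A H HA|xi eta An A _ Hlt HS HA].
  - contradiction.
  - now exists eta, An.
Qed.

Lemma Sigma0_open_inv xi A : ole xi OZ -> Sig xi A -> cantor_open A.
Proof. intros H0 H. destruct H; [assumption|contradiction]. Qed.

Lemma Sigma0_union xi (A : nat -> cantor -> Prop) :
  (forall n, Sig xi (A n)) -> Sig xi (fun x => exists n, A n x).
Proof.
  intro H. destruct (classic (ole xi OZ)) as [H0|H0].
  - apply Sig_open; auto. apply open_union. intro n. now apply Sigma0_open_inv with xi.
  - assert (H' : forall n, exists p : (nat -> ord) * (nat -> cantor -> Prop),
      (forall k, olt (fst p k) xi) /\ (forall k, Pi0 cantor_open (fst p k) (snd p k)) /\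
      forall x, A n x <-> exists k, snd p k x).
    { intro n. destruct (Sigma0_inv xi (A n) H0 (H n)) as [eta [An HAn]].
      now exists (eta, An). }
    apply functional_choice in H' as [p Hp].
    apply Sigma0_ext with (fun x => exists q, snd (p (unl q)) (unr q) x).
    + intro x. split.
      * intros [q Hq]. exists (unl q). apply (Hp (unl q)). eauto.
      * intros [n Hn]. apply (Hp n) in Hn as [k Hk]. exists (pairing n k).
        now rewrite unl_pairing, unr_pairing.
    + apply Sigma0_union_of_Pi0 with (fun q => fst (p (unl q)) (unr q)); auto;
        intro q; apply Hp.
Qed.

Lemma Sigma0_or xi A B : Sig xi A -> Sig xi B -> Sig xi (fun x => A x \/ B x).
Proof.
  intros HA HB.
  apply Sigma0_ext with (fun x => exists n, match n with 0 => A | S _ => B end x).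
  - intro x. split.
    + intros [[|n] Hn]; auto.
    + intros [Hx|Hx]; [now exists 0|now exists 1].
  - apply Sigma0_union. now intros [|n].
Qed.

Lemma Sigma0_and xi A B : Sig xi A -> Sig xi B -> Sig xi (fun x => A x /\ B x).
Proof.
  intros HA HB. destruct (classic (ole xi OZ)) as [H0|H0].
  - apply Sig_open; auto. apply open_inter; now apply Sigma0_open_inv with xi.
  - destruct (Sigma0_inv xi A H0 HA) as [eta [An [H1 [H2 H3]]]].
    destruct (Sigma0_inv xi B H0 HB) as [eta' [Bn [H1' [H2' H3']]]].
    apply Sigma0_ext with
      (fun x => exists n, exists m, An n x /\ Bn m x).
    + intro x. rewrite H3, H3'. firstorder.
    + apply Sigma0_union; intro n. apply Sigma0_union; intro m.
      (* Ordinals being comparable, both classes can be raised to the larger of [eta n] and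
         [eta' m], which is still below [xi]. *)
      assert (Hor : forall th, ole (eta n) th -> ole (eta' m) th ->
        Pi0 cantor_open th (fun x => An n x /\ Bn m x)).
      { intros th Hn Hm. unfold Pi0.
        apply Sigma0_ext with (fun x => ~ An n x \/ ~ Bn m x); [intro x; split; [tauto|apply not_and_or]|].
        apply Sigma0_or.
        - now apply Sigma0_mono with (eta n); [|apply H2].
        - now apply Sigma0_mono with (eta' m); [|apply H2']. }
      destruct (ole_or_olt (eta n) (eta' m)) as [H|H].
      * apply Pi0_Sigma0 with (eta' m); auto. apply Hor; auto. apply ole_refl.
      * apply Pi0_Sigma0 with (eta n); auto. apply Hor; [apply ole_refl|].
        now apply olt_ole.
Qed.

Lemma Pi0_mono eta xi A : ole eta xi -> Pi0 cantor_open eta A -> Pi0 cantor_open xi A.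
Proof. apply Sigma0_mono. Qed.

Lemma clopen_Pi0 xi C : clopen C -> Pi0 cantor_open xi C.
Proof. intro H. now apply clopen_Sigma0, clopen_not. Qed.

(** * Complexity of the maps *)

(** Asked of single coordinates only; finite intersections and countable unions extend it to the
    preimages of all open sets. *)
Definition in_class (nu : ord) (F : cantor -> cantor) : Prop :=
  forall i b, Sig nu (fun x => F x i = b).

Lemma in_class_open nu F U :
  in_class nu F -> cantor_open U -> Sig nu (fun x => U (F x)).
Proof.
  intros HF HU.
  apply Sigma0_ext with
    (fun x => exists k, cyl (word k) (F x) /\ forall y, cyl (word k) y -> U y).
  - intro x. split.
    + intros [k [H H']]. auto.
    + intro Hx. destruct (HU _ Hx) as [n Hn].
      destruct (word_surj (pref (F x) n)) as [k Hk]. exists k. rewrite Hk. split.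
      * now apply cyl_pref.
      * intros y Hy. apply Hn. now apply cyl_pref.
  - apply Sigma0_union; intro k. apply Sigma0_and.
    + generalize (word k); intro s.
      enough (H : forall n, Sig nu (fun x => forall i, i < n -> F x i = nth i s false))
        by apply (H (length s)).
      induction n as [|n IH].
      * apply clopen_Sigma0.
        apply clopen_ext with (fun _ => True); [|apply clopen_const].
        intro x. split; [intros _ i Hi; lia|auto].
      * apply Sigma0_ext with
          (fun x => (forall i, i < n -> F x i = nth i s false) /\ F x n = nth n s false).
        -- intro x. split.
           ++ intros [H H'] i Hi. destruct (Nat.eq_dec i n) as [->|]; auto.
              apply H. lia.
           ++ intro H. split; auto.
        -- apply Sigma0_and; auto.
    + apply clopen_Sigma0, clopen_const.
Qed.

(** Preimages of open sets start at level [nu], and each further level of [A] is added on the right.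
    Composition thus adds the ordinals in the order of application, as in the partial sums of
    [sel]. *)
Lemma in_class_preimage nu mu F A :
  in_class nu F -> Sig mu A -> Sig (oadd nu mu) (fun x => A (F x)).
Proof.
  intros HF H. induction H as [xi A H0 HA|xi eta An A H0 Hlt HS IH HA].
  - apply Sigma0_mono with nu; [apply ole_oadd_l|]. now apply in_class_open.
  - apply Sig_union with (fun n => oadd nu (eta n)) (fun n x => An n (F x)); auto.
    + intro H. apply H0. apply ole_trans with (2 := H), ole_oadd_r.
    + intro n. exact (oadd_mono nu _ _ (Hlt n)).
Qed.

Lemma in_class_id : in_class OZ (fun x => x).
Proof.
  intros i b. apply clopen_Sigma0. exists (S i).
  intros x y H <-. symmetry. apply H. lia.
Qed.

Lemma rho0_true eps i : rho0 eps i = true <-> forall j, eps (pairing i j) = false.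
Proof.
  unfold rho0. destruct excluded_middle_informative; split; auto; discriminate.
Qed.

Lemma rho0_false eps i : rho0 eps i = false <-> exists j, eps (pairing i j) = true.
Proof.
  unfold rho0. destruct excluded_middle_informative as [H|H].
  - split; [discriminate|]. intros [j Hj]. now rewrite H in Hj.
  - split; auto. intros _. apply not_all_ex_not in H as [j Hj].
    exists j. now destruct (eps (pairing i j)).
Qed.

(** At a limit, coordinate [i] is read off after steps [0] to [i], whose composition has as its
    class a partial sum of the sequence; [ole (osum (sel xi)) xi] keeps this class within [xi]. *)
Lemma rho_in_class sel Rho : good_sel sel -> rho_family sel Rho ->
  forall xi, in_class xi (Rho xi).
Proof.
  intros [_ Hsel] [_ [HZ [HS HL]]] xi.
  induction xi as [xi IH] using olt_ind.
  destruct (ord_cases xi) as [H|[[e H]|H]].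
  - intros i b. apply Sigma0_ext with (fun x => x i = b).
    + intro x. now rewrite HZ.
    + apply Sigma0_mono with OZ; [apply ole_zero|]. apply in_class_id.
  - assert (Hlt := oeq_OS_olt _ _ H). intros i [|].
    + apply Sigma0_ext with (fun x => forall j, Rho e x (pairing i j) = false).
      * intro x. now rewrite (HS xi e H x), rho0_true.
      * apply Pi0_Sigma0 with e; auto. unfold Pi0.
        apply Sigma0_ext with (fun x => exists j, Rho e x (pairing i j) = true).
        -- intro x. split.
           ++ intros [j Hj] N. now rewrite N in Hj.
           ++ intro N. apply not_all_ex_not in N as [j Hj]. exists j.
              now destruct (Rho e x (pairing i j)).
        -- apply Sigma0_union. intro j. now apply IH.
    + apply Sigma0_ext with (fun x => exists j, Rho e x (pairing i j) = true).
      * intro x. now rewrite (HS xi e H x), rho0_false.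
      * apply Sigma0_mono with e; [now apply olt_ole|].
        apply Sigma0_union. intro j. now apply IH.
  - destruct (Hsel xi H) as [Hk [Hsum Hsum']].
    assert (Hstep : forall k, in_class (sel xi k) (rho_step Rho sel xi k)).
    { intros k i b. unfold rho_step. destruct (Nat.ltb_spec i k) as [Hi|Hi].
      - apply Sigma0_mono with OZ; [apply ole_zero|]. apply in_class_id.
      - apply (Sigma0_preimage cantor_open cantor_open (fun eps j => eps (j + k))
          (sel xi k) (fun x => Rho (sel xi k) x (i - k) = b)).
        + intros U HU x Hx. destruct (HU _ Hx) as [n Hn]. exists (n + k).
          intros y Hy. apply Hn. intros j Hj. apply Hy. lia.
        + now apply IH, Hk. }
    assert (Hupto : forall k, in_class (opartial (sel xi) k) (rho_upto Rho sel xi (S k))).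
    { induction k as [|k IHk]; intros i b.
      - apply Hstep.
      - exact (in_class_preimage _ _ _ _ IHk (Hstep (S k) i b)). }
    intros i b. apply Sigma0_ext with (fun x => rho_upto Rho sel xi (S i) x i = b).
    + intro x. now rewrite (HL xi H x).
    + apply Sigma0_mono with (opartial (sel xi) i); [|apply Hupto].
      apply ole_trans with (2 := Hsum). apply ole_cocone with i, ole_refl.
Qed.
(** * Reductions to the maps *)

(** Lipschitz with constant 1/2 for the first-difference metric; in game terms, place [n] is
    answered before [a n] is seen. *)
Definition contractive (g : cantor -> cantor) : Prop :=
  forall n a b, (forall i, i < n -> a i = b i) -> g a n = g b n.

Lemma contractive_fixpoint g : contractive g -> exists a, g a = a.
Proof.
  intro Hg.
  pose (app := fix app n : cantor :=
    match n with
    | 0 => fun _ => false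
    | S n' => fun i => if Nat.eqb i n' then g (app n') n' else app n' i
    end).
  pose (a := fun n => g (app n) n).
  assert (H : forall n i, i < n -> app n i = a i).
  { induction n as [|n IH]; intros i Hi; [lia|]. simpl.
    destruct (Nat.eqb_spec i n) as [->|]; [reflexivity|]. apply IH. lia. }
  exists a. apply functional_extensionality; intro n. apply Hg.
  intros i Hi. symmetry. now apply H.
Qed.

Definition Win (Phi : cantor -> cantor) (m : nat) (C : cantor -> Prop) : Prop :=
  exists g, contractive g /\ forall a, Phi (g a) m = true <-> C a.

(** The map [p] gives each input place a single owner, so different output coordinates read disjoint
    sets of places. *)
Definition depends_via (p : nat -> nat) (Phi : cantor -> cantor) : Prop :=
  forall m x y, (forall i, p i = m -> x i = y i) -> Phi x m = Phi y m.

(* Strategies for the different coordinates act on disjoint sets of places. *)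
Lemma Win_all p Phi (D : nat -> cantor -> Prop) :
  depends_via p Phi -> (forall m, Win Phi m (D m)) ->
  exists g, contractive g /\ forall a m, Phi (g a) m = true <-> D m a.
Proof.
  intros Hp HW. apply functional_choice in HW as [G HG].
  exists (fun a i => G (p i) a i). split.
  - intros n a b H. apply HG. assumption.
  - intros a m. rewrite <- (proj2 (HG m) a).
    rewrite (Hp m _ (G m a)); [tauto|]. now intros i <-.
Qed.

Lemma depends_via_comp p q Phi Psi :
  depends_via p Phi -> depends_via q Psi ->
  depends_via (fun i => q (p i)) (fun x => Psi (Phi x)).
Proof.
  intros Hp Hq m x y H. apply Hq. intros j Hj. apply Hp. intros i Hi.
  apply H. now rewrite Hi.
Qed.

Lemma depends_via_tail p k Phi :
  depends_via p Phi -> depends_via (fun i => p i - k) (fun x j => Phi x (j + k)).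
Proof. intros Hp m x y H. apply Hp. intros i Hi. apply H. lia. Qed.

Lemma depends_via_rho0 : depends_via unl rho0.
Proof.
  intros m x y H.
  assert (H' : forall j, x (pairing m j) = y (pairing m j))
    by (intro j; apply H, unl_pairing).
  apply Bool.eq_true_iff_eq. rewrite !rho0_true.
  split; intros K j; [rewrite <- H'|rewrite H']; apply K.
Qed.

Section Family.

Context (sel : ord -> nat -> ord) (Rho : ord -> cantor -> cantor).
Hypothesis (Hsel : good_sel sel) (HRho : rho_family sel Rho).

Lemma Rho_OZ x eps : oeq x OZ -> Rho x eps = eps.
Proof. intro. now apply HRho. Qed.

Lemma Rho_OS x e eps : oeq x (OS e) -> Rho x eps = rho0 (Rho e eps).
Proof. intro. now apply HRho. Qed.

Lemma Rho_lim l eps m : is_limit l ->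
  Rho l eps m = Rho (sel l m) (fun j => rho_upto Rho sel l m eps (j + m)) 0.
Proof.
  intro H. destruct HRho as [_ [_ [_ HL]]]. rewrite (HL l H).
  unfold rho_lim. simpl. unfold rho_step. now rewrite Nat.ltb_irrefl, Nat.sub_diag.
Qed.

Lemma sel_olt l k : is_limit l -> olt (sel l k) l.
Proof. intro H. now apply Hsel. Qed.

Lemma sel_not_OZ l k : is_limit l -> ~ ole (sel l k) OZ.
Proof. intro H. now apply Hsel. Qed.

Lemma depends_via_rho_step p l k :
  depends_via p (Rho (sel l k)) ->
  depends_via (fun i => if Nat.ltb i k then i else p (i - k) + k) (rho_step Rho sel l k).
Proof.
  intros Hp m x y H. unfold rho_step. destruct (Nat.ltb_spec m k) as [Hm|Hm].
  - apply H. now destruct (Nat.ltb_spec m k); [|lia].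
  - apply Hp. intros i Hi. apply H. destruct (Nat.ltb_spec (i + k) k); [lia|].
    rewrite Nat.add_sub. lia.
Qed.

(** The bound [p i <= i] carries the limit case. The owner of place [i] can only decrease from step
    to step, and an owner [m] is frozen from stage [S m] on; since [m <= i], stage [S i] already
    shows the final owner. *)
Lemma Rho_depends_via xi : exists p, (forall i, p i <= i) /\ depends_via p (Rho xi).
Proof.
  induction xi as [xi IH] using olt_ind.
  destruct (ord_cases xi) as [H|[[e H]|H]].
  - exists (fun i => i). split; auto.
    intros m x y K. rewrite !Rho_OZ by assumption. auto.
  - destruct (IH e (oeq_OS_olt _ _ H)) as [p [Hle Hp]].
    exists (fun i => unl (p i)). split.
    + intro i. apply Nat.le_trans with (1 := unl_le _), Hle.
    + intros m x y K. rewrite !(Rho_OS xi e) by assumption. revert K.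
      now apply (depends_via_comp p unl (Rho e) rho0), depends_via_rho0.
  - assert (IH' : forall k, exists p, (forall i, p i <= i) /\
      depends_via p (Rho (sel xi k))) by (intro k; now apply IH, sel_olt).
    apply functional_choice in IH' as [P HP].
    pose (st k i := if Nat.ltb i k then i else P k (i - k) + k).
    pose (q := fix q k i := match k with 0 => i | S k' => st k' (q k' i) end).
    assert (Hst : forall k i, st k i <= i).
    { intros k i. unfold st. destruct (Nat.ltb_spec i k); [lia|].
      pose proof (proj1 (HP k) (i - k)). lia. }
    assert (Hq : forall k i, q k i <= i).
    { induction k as [|k IHk]; intro i; simpl; auto.
      apply Nat.le_trans with (1 := Hst _ _), IHk. }
    assert (Hup : forall k, depends_via (q k) (rho_upto Rho sel xi k)).
    { induction k as [|k IHk].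
      - intros m x y K. now apply K.
      - apply (depends_via_comp (q k) (st k) _ _ IHk).
        now apply depends_via_rho_step, HP. }
    assert (Hstable : forall m i d, q (S m) i = m -> q (S m + d) i = m).
    { intros m i d K. induction d as [|d IHd].
      - now rewrite Nat.add_0_r.
      - rewrite Nat.add_succ_r. simpl. simpl in IHd. rewrite IHd.
        unfold st at 1. now destruct (Nat.ltb_spec m (S (m + d))); [|lia]. }
    exists (fun i => q (S i) i). split; auto.
    intros m x y K. destruct HRho as [_ [_ [_ HL]]]. rewrite !(HL xi H).
    unfold rho_lim. apply Hup. intros i Hi. apply K.
    pose proof (Hq (S m) i) as Hmi. rewrite Hi in Hmi.
    replace (S i) with (S m + (i - m)) by lia. now apply Hstable.
Qed.

(** * Winning strategies at every level of the hierarchy *)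

Definition low (mu : ord) (C : cantor -> Prop) : Prop :=
  clopen C \/ exists th, olt th mu /\ Pi0 cantor_open th C.

(** At level zero there is no lower class, and the clopen pieces of an open complement take its
    place; hence the first alternative in [low]. *)
Lemma Pi0_low mu C : Pi0 cantor_open mu C ->
  exists A : nat -> cantor -> Prop, (forall n, low mu (A n)) /\
    forall x, C x <-> forall n, ~ A n x.
Proof.
  intro H. destruct (classic (ole mu OZ)) as [H0|H0].
  - apply (Sigma0_open_inv _ _ H0) in H. destruct (open_cyls _ H) as [A [HA HCA]].
    exists A. split; [now left; apply HA|].
    intro x. rewrite <- (NNPP_iff (C x)), HCA.
    split; [intros K n Hn|intros K [n Hn]]; [apply K|apply (K n)]; eauto.
  - destruct (Sigma0_inv _ _ H0 H) as [eta [A [H1 [H2 H3]]]].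
    exists A. split; [intro n; right; now exists (eta n)|].
    intro x. rewrite <- (NNPP_iff (C x)), H3.
    split; [intros K n Hn|intros K [n Hn]]; [apply K|apply (K n)]; eauto.
Qed.

(** The second clause supplies a neutral move. The third promises late coordinates only: for the
    identity, the strategy at place [m] has seen [m] bits, which must suffice to decide the clopen
    set. *)
Definition independent_fun (mu : ord) (Phi : cantor -> cantor) : Prop :=
  (exists p, depends_via p Phi) /\
  (forall m, Win Phi m (fun _ => False)) /\
  (forall C, low mu C -> exists N, forall m, N <= m -> Win Phi m C).

(** The complement of [C] is a union of low sets, and a column is to show a one exactly when some of
    them contains [a]. A place where its assigned set cannot be won gets the neutral strategy; late
    enough places miss no set. *)
Lemma independent_fun_spread mu Phi C :
  independent_fun mu Phi -> Pi0 cantor_open mu C ->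
  exists g, contractive g /\
    forall a m, C a <-> forall j, Phi (g a) (pairing m j) = false.
Proof.
  intros [[p Hp] [Hemp Hlow]] HC.
  destruct (Pi0_low _ _ HC) as [A [HA HCA]].
  (* every [A n] is tried at infinitely many places of each column *)
  pose (D k x := Win Phi k (A (unl (unr k))) /\ A (unl (unr k)) x).
  destruct (Win_all p Phi D Hp) as [g [Hg HgD]].
  { intro k. destruct (classic (Win Phi k (A (unl (unr k))))) as [W|W].
    - pose proof W as [g [Hg Hga]]. exists g. split; auto.
      intro a. rewrite Hga. unfold D. tauto.
    - destruct (Hemp k) as [g [Hg Hga]]. exists g. split; auto.
      intro a. rewrite Hga. unfold D. tauto. }
  exists g. split; auto. intros a m. rewrite HCA. split.
  - intros K j. apply Bool.not_true_is_false. rewrite HgD. intros [_ HD].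
    now apply K in HD.
  - intros K n Hn. destruct (Hlow _ (HA n)) as [N HN].
    (* The place [pairing m (pairing n N)] lies in column [m], is assigned the set [A n], and is at
       least [N]. *)
    specialize (K (pairing n N)). apply Bool.diff_true_false.
    rewrite <- K. symmetry. apply HgD. unfold D.
    rewrite unr_pairing, unl_pairing. split; auto. apply HN.
    apply Nat.le_trans with (pairing n N); apply pairing_ge_r.
Qed.

Lemma Win_rho0 mu Phi C m :
  independent_fun mu Phi -> Pi0 cantor_open mu C -> Win (fun x => rho0 (Phi x)) m C.
Proof.
  intros HPhi HC. destruct (independent_fun_spread _ _ _ HPhi HC) as [g [Hg HgC]].
  exists g. split; auto. intro a. now rewrite rho0_true, (HgC a m).
Qed.

Lemma independent_fun_tail mu Phi k :
  independent_fun mu Phi -> independent_fun mu (fun x j => Phi x (j + k)).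
Proof.
  intros [[p Hp] [Hemp Hlow]]. split; [|split].
  - eexists. apply depends_via_tail. exact Hp.
  - intro m. apply Hemp.
  - intros C HC. destruct (Hlow C HC) as [N HN]. exists N. intros m Hm.
    apply HN. lia.
Qed.

Lemma Win_ext Phi Psi m C D :
  (forall x, Phi x m = Psi x m) -> (forall a, C a <-> D a) -> Win Phi m C -> Win Psi m D.
Proof.
  intros H HCD [g [Hg HgC]]. exists g. split; auto. intro a.
  now rewrite <- H, HgC.
Qed.

(* At [nu > 0] the reduction works at every coordinate, not just eventually:
   at a limit stage the [m]-th coordinate is coordinate [0] of [Rho (sel l m)]. *)
Lemma Rho_independent nu : forall mu Phi, independent_fun mu Phi ->
  independent_fun (oadd mu nu) (fun x => Rho nu (Phi x)) /\
  (~ ole nu OZ -> forall m C, Pi0 cantor_open mu C -> Win (fun x => Rho nu (Phi x)) m C).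
Proof.
  induction nu as [nu IH] using olt_ind. intros mu Phi HPhi.
  assert (Hdep : exists p, depends_via p (fun x => Rho nu (Phi x))).
  { destruct HPhi as [[p Hp] _]. destruct (Rho_depends_via nu) as [q [_ Hq]].
    eexists. exact (depends_via_comp _ _ _ _ Hp Hq). }
  destruct (ord_cases nu) as [H|[[e H]|H]].
  - split; [|intros N; now destruct N, H].
    destruct HPhi as [_ [Hemp Hlow]]. split; [assumption|split].
    + intro m. apply (Win_ext Phi _ m (fun _ => False) _); auto; [|tauto].
      intro x. now rewrite Rho_OZ.
    + intros C HC. destruct (Hlow C) as [N HN].
      { destruct HC as [HC|[th [Hth HC]]]; [now left|right; exists th; split; auto].
        apply ole_trans with (1 := Hth). apply (oadd_mono mu nu OZ), H. }
      exists N. intros m Hm. apply (Win_ext Phi _ m C _); auto; [|tauto].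
      intro x. now rewrite Rho_OZ.
  - destruct (IH e (oeq_OS_olt _ _ H) mu Phi HPhi) as [He _].
    assert (HW : forall m C, Pi0 cantor_open (oadd mu e) C ->
      Win (fun x => Rho nu (Phi x)) m C).
    { intros m C HC. apply (Win_ext (fun x => rho0 (Rho e (Phi x))) _ m C _); [|tauto|].
      - intro x. now rewrite (Rho_OS nu e).
      - now apply Win_rho0 with (oadd mu e). }
    split; [split; [assumption|split]|].
    + intro m. apply HW, clopen_Pi0, clopen_const.
    + intros C [HC|[th [Hth HC]]]; exists 0; intros m _; apply HW.
      * now apply clopen_Pi0.
      * apply Pi0_mono with (2 := HC). apply ole_OS_inv.
        apply ole_trans with (1 := Hth). apply (oadd_mono mu nu (OS e)), H.
    + intros _ m C HC. apply HW. apply Pi0_mono with (2 := HC), ole_oadd_l.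
  (* [Ms k] is the level attained after [k] steps: [mu] plus the first [k] terms of the sequence. *)
  - pose (Ms := fix Ms k := match k with 0 => mu | S k' => oadd (Ms k') (sel nu k') end).
    pose (Ph k x := rho_upto Rho sel nu k (Phi x)).
    assert (HPh : forall k, independent_fun (Ms k) (Ph k)).
    { induction k as [|k IHk]; [assumption|].
      pose proof (independent_fun_tail _ _ k IHk) as Htail.
      destruct (IH (sel nu k) (sel_olt nu k H) _ _ Htail) as [[_ [Hemp' Hlow']] _].
      destruct IHk as [[p Hp] [Hemp Hlow]]. clear Htail.
      assert (Hlt : forall m C, m < k -> Win (Ph k) m C -> Win (Ph (S k)) m C).
      { intros m C Hm. apply Win_ext; [|tauto]. intro x. unfold Ph. simpl.
        unfold rho_step. now destruct (Nat.ltb_spec m k); [|lia]. }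
      assert (Hge : forall m C, k <= m ->
        Win (fun x => Rho (sel nu k) (fun j => Ph k x (j + k))) (m - k) C ->
        Win (Ph (S k)) m C).
      { intros m C Hm [g [Hg HgC]]. exists g. split; auto. intro a.
        rewrite <- HgC. unfold Ph. simpl.
        unfold rho_step. destruct (Nat.ltb_spec m k); [lia|tauto]. }
      split; [|split].
      - destruct (Rho_depends_via (sel nu k)) as [q [_ Hq]].
        eexists. exact (depends_via_comp _ _ _ _ Hp (depends_via_rho_step q nu k Hq)).
      - intro m. destruct (Nat.lt_ge_cases m k); auto.
      - intros C HC. destruct (Hlow' C HC) as [N HN]. exists (N + k).
        intros m Hm. apply Hge; [lia|]. apply HN. lia. }
    assert (HW : forall m C, Pi0 cantor_open (Ms m) C -> Win (fun x => Rho nu (Phi x)) m C).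
    { intros m C HC. pose proof (independent_fun_tail _ _ m (HPh m)) as Htail.
      destruct (IH (sel nu m) (sel_olt nu m H) _ _ Htail) as [_ HWm].
      destruct (HWm (sel_not_OZ nu m H) 0 C HC) as [g [Hg HgC]].
      exists g. split; auto. intro a. now rewrite <- HgC, Rho_lim. }
    assert (HMs : forall n, Ms (S n) = oadd mu (opartial (sel nu) n)).
    { induction n as [|n IHn]; [reflexivity|]. change (Ms (S (S n))) with
        (oadd (Ms (S n)) (sel nu (S n))). now rewrite IHn, oadd_assoc. }
    assert (Hmono : forall n d, ole (Ms n) (Ms (n + d))).
    { intros n d. induction d as [|d IHd].
      - rewrite Nat.add_0_r. apply ole_refl.
      - rewrite Nat.add_succ_r. apply ole_trans with (1 := IHd), ole_oadd_l. }
    split; [split; [assumption|split]|].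
    + intro m. apply HW, clopen_Pi0, clopen_const.
    + intros C [HC|[th [Hth HC]]].
      * exists 0. intros m _. now apply HW, clopen_Pi0.
      (* Here the inequality [ole nu (osum (sel nu))] enters: the partial sums exhaust [nu], so [th]
         lies below one of the levels, and all later coordinates win. *)
      * assert (Hk : exists n, olt th (Ms (S n))).
        { destruct Hsel as [_ Hs]. destruct (Hs nu H) as [_ [_ Hsum]].
          pose proof (ole_trans _ _ _ Hth (oadd_mono mu _ _ Hsum)) as K.
          apply ole_OS_OL in K as [n Hn]. exists n. now rewrite HMs. }
        destruct Hk as [n Hn]. exists (S n). intros m Hm. apply HW.
        apply Pi0_mono with (2 := HC). apply ole_trans with (1 := olt_ole _ _ Hn).
        replace m with (S n + (m - S n)) by lia. apply Hmono.
    + intros _ m C HC. apply HW. apply Pi0_mono with (2 := HC). apply (Hmono 0).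
Qed.

Lemma independent_fun_id : independent_fun OZ (fun x => x).
Proof.
  assert (HW : forall m C, (forall x y, (forall i, i < m -> x i = y i) -> C x -> C y) ->
    Win (fun x => x) m C).
  { intros m C HC.
    exists (fun a i => if Nat.eqb i m then
      (if excluded_middle_informative (C a) then true else false) else false). split.
    - intros n a b H. destruct (Nat.eqb_spec n m) as [->|]; auto.
      destruct (excluded_middle_informative (C a)) as [Ha|Ha],
        (excluded_middle_informative (C b)) as [Hb|Hb]; auto; exfalso; eauto.
      apply Ha, HC with b; auto. intros; symmetry; auto.
    - intro a. rewrite Nat.eqb_refl.
      destruct (excluded_middle_informative (C a)); split; easy. }
  split; [|split].
  - exists (fun i => i). intros m x y H. now apply H.
  - intro m. apply HW. auto.
  - intros C [HC|[th [Hth _]]]; [|now apply not_OS_OZ in Hth].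
    destruct HC as [N HN]. exists N. intros m Hm. apply HW.
    intros x y H. apply HN. intros i Hi. apply H. lia.
Qed.

(** The columns exhaust all places and all carry the same set [C], so the image vanishes everywhere
    as soon as it vanishes on one column. *)
Lemma H_reduction xi C : Pi0 cantor_open xi C ->
  exists g, contractive g /\ forall a, C a <-> H_set Rho xi (g a).
Proof.
  intro HC. destruct (Rho_independent xi OZ _ independent_fun_id) as [H _].
  rewrite oadd_OZ_l in H.
  destruct (independent_fun_spread _ _ _ H HC) as [g [Hg HgC]].
  exists g. split; auto. intro a. unfold H_set. split.
  - intros Ha i. rewrite <- (pairing_un i). now apply HgC.
  - intro Ha. apply (HgC a 0). auto.
Qed.

Lemma H_not_Sigma0 xi : ~ Sig xi (H_set Rho xi).
Proof.
  intro H. destruct (H_reduction xi (fun x => ~ H_set Rho xi x)) as [g [Hg HgH]].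
  { unfold Pi0. now rewrite set_notnot. }
  destruct (contractive_fixpoint g Hg) as [a Ha].
  specialize (HgH a). rewrite Ha in HgH. tauto.
Qed.

Lemma H_Pi0 xi : Pi0 cantor_open xi (H_set Rho xi).
Proof.
  apply Sigma0_ext with (fun x => exists i, Rho xi x i = true).
  - intro x. unfold H_set. split.
    + intros [i Hi] N. now rewrite N in Hi.
    + intro N. apply not_all_ex_not in N as [i Hi]. exists i.
      now destruct (Rho xi x i).
  - apply Sigma0_union. intro i. now apply rho_in_class with sel.
Qed.

(** Every nonzero iterate begins with [rho0]. At a limit this is seen in step [0], which applies
    [Rho (sel xi 0)] to the whole sequence, with [sel xi 0] nonzero. *)
Lemma Rho_rho0 xi x y : ~ ole xi OZ -> rho0 x = rho0 y -> Rho xi x = Rho xi y.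
Proof.
  intros H0 Hxy. induction xi as [xi IH] using olt_ind.
  destruct (ord_cases xi) as [H|[[e H]|H]].
  - now destruct H0, H.
  - rewrite !(Rho_OS xi e) by assumption.
    destruct (classic (ole e OZ)) as [He|He].
    + rewrite !(Rho_OZ e) by (split; [assumption|apply ole_zero]). assumption.
    + now rewrite (IH e (oeq_OS_olt _ _ H) He).
  - assert (Hup : forall k, rho_upto Rho sel xi (S k) x = rho_upto Rho sel xi (S k) y).
    { induction k as [|k IHk].
      - apply functional_extensionality; intro i. simpl. unfold rho_step. simpl.
        rewrite Nat.sub_0_r.
        pose proof (IH (sel xi 0) (sel_olt xi 0 H) (sel_not_OZ xi 0 H)) as K.
        assert (Hz : forall z : cantor, (fun j => z (j + 0)) = z).
        { intro z. apply functional_extensionality; intro j. now rewrite Nat.add_0_r. }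
        now rewrite !Hz, K.
      - change (rho_step Rho sel xi (S k) (rho_upto Rho sel xi (S k) x) =
          rho_step Rho sel xi (S k) (rho_upto Rho sel xi (S k) y)).
        now rewrite IHk. }
    destruct HRho as [_ [_ [_ HL]]]. rewrite !(HL xi H).
    apply functional_extensionality; intro k. unfold rho_lim. now rewrite Hup.
Qed.

(** For [xi] zero the map is the identity and sees more than the columns, but [H_set] then contains
    the zero sequence alone, which is characterized by all columns being empty. *)
Lemma H_set_columns xi x y :
  (forall m, (exists j, x (pairing m j) = true) <-> (exists j, y (pairing m j) = true)) ->
  H_set Rho xi x <-> H_set Rho xi y.
Proof.
  intro Hxy. unfold H_set. destruct (classic (ole xi OZ)) as [H0|H0].
  - assert (H : oeq xi OZ) by (split; [assumption|apply ole_zero]).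
    rewrite !Rho_OZ by assumption.
    assert (K : forall u v, (forall m, (exists j, u (pairing m j) = true) <->
      (exists j, v (pairing m j) = true)) ->
      (forall i : nat, u i = false) -> forall i, v i = false).
    { intros u v Huv Hu i. apply Bool.not_true_is_false. intro N.
      destruct (proj2 (Huv (unl i))) as [j Hj].
      - exists (unr i). now rewrite pairing_un.
      - now rewrite Hu in Hj. }
    split; apply K; [|intro m; symmetry]; auto.
  - rewrite (Rho_rho0 xi x y); [tauto|assumption|].
    apply functional_extensionality; intro m.
    enough (K : rho0 x m = false <-> rho0 y m = false).
    { destruct (rho0 x m), (rho0 y m); auto; [now apply K|symmetry; now apply K]. }
    now rewrite !rho0_false.
Qed.

End Family.
(** * Category in the Cantor space *)

Definition nowhere_dense (F : cantor -> Prop) : Prop :=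
  forall s, exists x, forall y, cyl (s ++ x) y -> ~ F y.

Definition meager (A : cantor -> Prop) : Prop :=
  exists F : nat -> cantor -> Prop,
    (forall n, nowhere_dense (F n)) /\ forall y, A y -> exists n, F n y.

Lemma nowhere_dense_meager F : nowhere_dense F -> meager F.
Proof. intro H. exists (fun _ => F). split; auto. intros y Hy. now exists 0. Qed.

Lemma meager_subset (A B : cantor -> Prop) :
  (forall y, A y -> B y) -> meager B -> meager A.
Proof. intros H [F [HF HB]]. exists F. auto. Qed.

Lemma meager_empty (A : cantor -> Prop) : (forall y, ~ A y) -> meager A.
Proof.
  intro H. apply nowhere_dense_meager. intro s. exists []. auto.
Qed.

Lemma nonmeager_point (A : cantor -> Prop) : ~ meager A -> exists y, A y.
Proof.
  intro H. apply NNPP; intro N. apply H, meager_empty. eauto.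
Qed.

Lemma meager_union (A : nat -> cantor -> Prop) :
  (forall n, meager (A n)) -> meager (fun y => exists n, A n y).
Proof.
  intro H. apply functional_choice in H as [F HF].
  exists (fun q => F (unl q) (unr q)). split.
  - intro q. apply HF.
  - intros y [n Hn]. apply HF in Hn as [k Hk]. exists (pairing n k).
    now rewrite unl_pairing, unr_pairing.
Qed.

Definition word_lim (w : nat -> list bool) : cantor := fun i => nth i (w (S i)) false.

Lemma word_lim_spec (w : nat -> list bool) :
  (forall n, exists x b, w (S n) = w n ++ x ++ [b]) ->
  forall n, n <= length (w n) /\ cyl (w n) (word_lim w).
Proof.
  intro H.
  assert (Hlen : forall n, n <= length (w n)).
  { induction n as [|n IH]; [lia|]. destruct (H n) as [x [b ->]].
    rewrite !length_app. simpl. lia. }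
  assert (Hext : forall n d, exists x, w (n + d) = w n ++ x).
  { intros n d. induction d as [|d [x IH]].
    - exists []. now rewrite Nat.add_0_r, app_nil_r.
    - destruct (H (n + d)) as [y [b Hy]]. exists (x ++ y ++ [b]).
      now rewrite Nat.add_succ_r, Hy, IH, <- !app_assoc. }
  intro n. split; auto. intros i Hi. unfold word_lim.
  pose proof (Hlen (S i)) as Hi'.
  destruct (Nat.le_ge_cases n (S i)) as [Hn|Hn].
  - destruct (Hext n (S i - n)) as [x Hx].
    replace (n + (S i - n)) with (S i) in Hx by lia. rewrite Hx. now apply app_nth1.
  - destruct (Hext (S i) (n - S i)) as [x Hx].
    replace (S i + (n - S i)) with n in Hx by lia. rewrite Hx. symmetry.
    apply app_nth1. lia.
Qed.

Lemma baire s : ~ meager (cyl s).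
Proof.
  intros [F [HF Hs]].
  assert (H : forall p : nat * list bool, exists x, forall y,
    cyl (snd p ++ x) y -> ~ F (fst p) y) by (intros [n u]; apply HF).
  apply functional_choice in H as [X HX].
  (* The extra [[false]] makes the words grow even where [X] returns the empty word. *)
  pose (w := fix w n := match n with 0 => s | S n' => w n' ++ X (n', w n') ++ [false] end).
  assert (Hw : forall n, exists x b, w (S n) = w n ++ x ++ [b])
    by (intro n; now exists (X (n, w n)), false).
  pose proof (word_lim_spec w Hw) as Hlim.
  destruct (Hs (word_lim w) (proj2 (Hlim 0))) as [n Hn].
  apply (HX (n, w n)) in Hn; auto. simpl.
  apply cyl_app with [false]. rewrite <- app_assoc. apply (Hlim (S n)).
Qed.

Definition nonmeager_in (t : list bool) (A : cantor -> Prop) : Prop :=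
  forall x, ~ meager (fun y => A y /\ cyl (t ++ x) y).

(** Banach's category argument: otherwise the cylinders in which [A] is meager are dense. The points
    outside all of them form a nowhere dense set, and the countably many cylinders each contribute a
    meager part of [A]. *)
Lemma nonmeager_localize A : ~ meager A -> exists u, nonmeager_in u A.
Proof.
  intro HA. apply NNPP; intro N. apply HA.
  assert (Hx : forall u, exists x, meager (fun y => A y /\ cyl (u ++ x) y)).
  { intro u. apply NNPP; intro K. apply N. exists u. intros x Hx. eauto. }
  apply meager_subset with (fun y => exists n, match n with
    | 0 => forall k, ~ meager (fun z => A z /\ cyl (pref y k) z)
    | S n => meager (fun z => A z /\ cyl (word n) z) /\ A y /\ cyl (word n) y
    end).
  - intros y Hy.
    destruct (classic (forall k, ~ meager (fun z => A z /\ cyl (pref y k) z))) as [K|K].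
    + now exists 0.
    + apply not_all_ex_not in K as [k Hk]. apply NNPP in Hk.
      destruct (word_surj (pref y k)) as [n Hn]. exists (S n). rewrite Hn.
      split; [assumption|split; [assumption|now apply cyl_pref]].
  - apply meager_union. intros [|n].
    + apply nowhere_dense_meager. intro s. destruct (Hx s) as [x Hsx]. exists x.
      intros y Hy K. apply (K (length (s ++ x))). now rewrite cyl_unique.
    + destruct (classic (meager (fun z => A z /\ cyl (word n) z))) as [K|K].
      * apply meager_subset with (2 := K). tauto.
      * apply meager_empty. tauto.
Qed.

(** By separability countably many balls of radius [e / 2] cover the set, so its part in one of them
    is nonmeager. *)
Lemma nonmeager_shrink (d : cantor -> cantor -> R) (q : nat -> cantor) t A e :
  (forall x y, d x y = d y x) -> (forall x y z, d x z <= d x y + d y z)%R ->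
  (forall x e, 0 < e -> exists n, d x (q n) < e)%R ->
  (0 < e)%R -> nonmeager_in t A ->
  exists V u, (forall y, V y -> A y) /\ (forall y z, V y -> V z -> d y z <= e)%R /\
    nonmeager_in (t ++ u) V.
Proof.
  intros Hsym Htri Hq He HA.
  assert (H : exists n, ~ meager (fun y => (A y /\ cyl t y) /\ (d y (q n) < e / 2)%R)).
  { apply NNPP; intro N. apply (HA []). rewrite app_nil_r.
    apply meager_subset with
      (fun y => exists n, (A y /\ cyl t y) /\ (d y (q n) < e / 2)%R).
    - intros y Hy. destruct (Hq y (e / 2)%R) as [n Hn]; [lra|]. now exists n.
    - apply meager_union. intro n. apply NNPP; intro K. eauto. }
  destruct H as [n Hn]. apply nonmeager_localize in Hn as [u Hu].
  set (V := fun y => (A y /\ cyl t y) /\ (d y (q n) < e / 2)%R) in *.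
  (* Localization may return a word shorter than [t]. Padding makes it long enough, and a point of
     [V] in the padded cylinder lies in [cyl t], so the padded word extends [t]. *)
  destruct (nonmeager_point _ (Hu (repeat false (length t)))) as [z [[[_ Hz] _] Hz']].
  assert (Ht : exists x, u ++ repeat false (length t) = t ++ x).
  { exists (skipn (length t) (u ++ repeat false (length t))).
    rewrite <- (firstn_skipn (length t) (u ++ repeat false (length t))) at 1. f_equal.
    rewrite <- (cyl_firstn _ z) by (assumption || rewrite length_app, repeat_length; lia).
    now apply cyl_unique. }
  destruct Ht as [x Hx]. exists V, x. repeat split.
  - intros y [[Hy _] _]. assumption.
  - intros y y' [_ Hy] [_ Hy']. specialize (Htri y (q n) y'). rewrite (Hsym (q n)) in Htri.
    lra.
  - intro y. rewrite <- Hx, <- app_assoc. apply Hu.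
Qed.

(** * The reduction into the tree *)

Lemma dependent_choice_inv {A : Type} (I : nat -> A -> Prop) (N : nat -> A -> A -> Prop) a0 :
  I 0 a0 -> (forall k a, I k a -> exists b, I (S k) b /\ N k a b) ->
  exists f : nat -> A, f 0 = a0 /\ forall k, I k (f k) /\ N k (f k) (f (S k)).
Proof.
  intros H0 Hstep.
  assert (H : forall p : nat * A, exists b, I (fst p) (snd p) ->
    I (S (fst p)) b /\ N (fst p) (snd p) b).
  { intros [k a]. destruct (classic (I k a)) as [Ha|Ha].
    - destruct (Hstep k a Ha) as [b Hb]. now exists b.
    - exists a. tauto. }
  apply functional_choice in H as [F HF].
  pose (f := fix f k := match k with 0 => a0 | S k' => F (k', f k') end).
  assert (Hf : forall k, I k (f k)).
  { induction k as [|k IH]; [assumption|]. apply (HF (k, f k) IH). }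
  exists f. split; auto. intro k. split; auto. apply (HF (k, f k) (Hf k)).
Qed.

(** [in_tree] without the root: a node of this kind carries the pair in [E] to which the extension
    clause of the test is applied. *)
Definition tree_node (E : list bool -> list bool -> Prop) (s t : list bool) : Prop :=
  exists s' t' w, E s' t' /\ s = s' ++ false :: w /\ t = t' ++ true :: w.

Lemma tree_node_app E s t x : tree_node E s t -> tree_node E (s ++ x) (t ++ x).
Proof.
  intros [s' [t' [w [HE [-> ->]]]]]. exists s', t', (w ++ x).
  now rewrite <- !app_assoc.
Qed.

Section Test.

Context (E : list bool -> list bool -> Prop).
Hypothesis HE : is_test E.

Lemma test_length s t : E s t -> length s = length t.
Proof. apply HE. Qed.

Lemma tree_node_length s t : tree_node E s t -> length s = length t /\ 0 < length s.
Proof.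
  intros [s' [t' [w [H [-> ->]]]]]. rewrite !length_app, (test_length _ _ H). simpl. lia.
Qed.

Lemma test_nil : E [] [].
Proof.
  destruct HE as [Hlen [Huniq _]]. destruct (Huniq 0) as [s [t [Hs [H _]]]].
  assert (Ht := Hlen _ _ H). rewrite Hs in Ht.
  destruct s; [|discriminate]. now destruct t.
Qed.

(** Cutting [s' ++ false :: w] inside [s'] leads to a prefix of a pair in [E]. By the last clause of
    the test such a pair, if nonempty, is itself a node over a shorter pair, so induction on the
    length applies. *)
Lemma in_tree_firstn s t n :
  E s t \/ tree_node E s t -> in_tree E (firstn n s) (firstn n t).
Proof.
  revert s t. enough (H : forall N s t, length s <= N -> E s t \/ tree_node E s t ->
    in_tree E (firstn n s) (firstn n t)) by (intros s t; now apply (H (length s))).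
  induction N as [|N IH]; intros s t HN H.
  - left. destruct s; [|simpl in HN; lia]. destruct H as [H|H].
    + apply test_length in H. destruct t; [|discriminate]. now rewrite !firstn_nil.
    + apply tree_node_length in H as [_ H]. simpl in H. lia.
  - assert (H' : (s = [] /\ t = []) \/ tree_node E s t).
    { destruct H as [H|H]; [|now right]. destruct s as [|b s].
      - left. apply test_length in H. now destruct t.
      - right. destruct HE as [_ [_ [_ Hc]]].
        destruct (Hc (length (b :: s)) (b :: s) t) as [q [s' [t' [w [_ [H1 [_ H2]]]]]]];
          [simpl; lia|assumption|reflexivity|].
        now exists s', t', w. }
    destruct H' as [[-> ->]|[s' [t' [w [H' [-> ->]]]]]].
    + left. now rewrite !firstn_nil.
    + assert (Hlen := test_length _ _ H').
      destruct (Nat.le_gt_cases n (length s')) as [Hn|Hn].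
      * rewrite !firstn_app, <- Hlen. replace (n - length s') with 0 by lia.
        simpl. rewrite !app_nil_r. apply IH; auto.
        rewrite length_app in HN. simpl in HN. lia.
      * right. exists s', t', (firstn (n - length s' - 1) w). split; auto.
        rewrite !firstn_app, <- Hlen, (firstn_all2 s'), (firstn_all2 t') by lia.
        destruct (n - length s') as [|k] eqn:Hk; [lia|].
        simpl. rewrite Nat.sub_0_r. auto.
Qed.

(* The branches of [2^<omega] are numbered as in a binary heap: stage [k] of the
   construction splits the branch [k], and the branches alive at stage [k] are
   those numbered from [k] to [2 * k]. *)
Definition child (k : nat) (b : bool) : nat := 2 * k + (if b then 2 else 1).
Definition depth (k : nat) : nat := Nat.log2 (S k).

Lemma depth_child k b : depth (child k b) = S (depth k).
Proof.
  unfold depth, child. destruct b.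
  - replace (S (2 * k + 2)) with (2 * S k + 1) by lia. apply Nat.log2_succ_double. lia.
  - replace (S (2 * k + 1)) with (2 * S k) by lia. apply Nat.log2_double. lia.
Qed.

Lemma depth_le k : depth k <= k.
Proof. unfold depth. pose proof (Nat.log2_lt_lin (S k)). lia. Qed.

(* the branch alive at stage [k] along which [a] passes *)
Fixpoint alive (a : cantor) (k : nat) : nat :=
  match k with
  | 0 => 0
  | S k' => if Nat.eqb (alive a k') k' then child k' (a (depth k')) else alive a k'
  end.

Lemma alive_bounds a k : k <= alive a k <= 2 * k.
Proof.
  induction k as [|k IH]; simpl; [lia|].
  destruct (Nat.eqb_spec (alive a k) k); [|lia].
  unfold child. destruct (a (depth k)); lia.
Qed.

Lemma alive_local a b N : (forall i, i < N -> b i = a i) -> alive b N = alive a N.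
Proof.
  induction N as [|N IH]; intro H; simpl; auto. rewrite IH by auto.
  rewrite H by (pose proof (depth_le N); lia). reflexivity.
Qed.

(** After a split the child has a larger number and stays alive unchanged until the stage of that
    number. *)
Lemma alive_hits a n : exists k, n <= k /\ alive a k = k /\ depth k = n.
Proof.
  induction n as [|n [k [Hk [Hak Hd]]]].
  - now exists 0.
  - exists (child k (a n)). split; [|split].
    + unfold child. destruct (a n); lia.
    + assert (H : forall i, S k + i <= child k (a n) -> alive a (S k + i) = child k (a n)).
      { induction i as [|i IH]; intro Hi.
        - rewrite Nat.add_0_r. simpl. rewrite Hak, Nat.eqb_refl. now rewrite Hd.
        - rewrite Nat.add_succ_r in *. simpl. simpl in IH. rewrite IH by lia.
          destruct (Nat.eqb_spec (child k (a n)) (S (k + i))); [lia|reflexivity]. }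
      pose proof (H (child k (a n) - S k)) as H'.
      assert (Hlt : S k <= child k (a n)) by (unfold child; destruct (a n); lia).
      replace (S k + (child k (a n) - S k)) with (child k (a n)) in H' by lia. auto.
    + now rewrite depth_child, Hd.
Qed.

Context (d : cantor -> cantor -> R) (q : nat -> cantor).
Hypothesis Hsym : forall x y, d x y = d y x.
Hypothesis Htri : (forall x y z, d x z <= d x y + d y z)%R.
Hypothesis Hq : (forall x e, 0 < e -> exists n, d x (q n) < e)%R.
Hypothesis Hfiner : forall U, cantor_open U ->
  (forall x, U x -> exists e, 0 < e /\ forall y, d x y < e -> U y)%R.
Hypothesis Hcomplete : forall u : nat -> cantor,
  (forall e, (0 < e)%R -> exists N, forall n m, N <= n -> N <= m -> (d (u n) (u m) < e)%R) ->
  exists l, forall e, (0 < e)%R -> exists N, forall n, N <= n -> (d (u n) l < e)%R.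

(** The word [st_s] is shared by all branches because [a0] must not depend on [a]; [st_U] confines
    the limits in the metric [d]. *)
Record stage := { st_s : list bool; st_t : nat -> list bool; st_U : nat -> cantor -> Prop }.

Definition stage_inv (k : nat) (P : stage) : Prop :=
  forall j, k <= j <= 2 * k ->
    tree_node E (st_s P) (st_t P j) /\ nonmeager_in (st_t P j) (st_U P j).

(** The common [u] creates no difference between the coordinates; the only new one is the last
    letter of [child k true], allowed because the extended pair lies in [E]. Its position, lowered
    by one for the later shift, is in the column of [depth k], the index of the bit of [a] that
    decides this split. *)
Definition stage_next (k : nat) (P P' : stage) : Prop :=
  exists u, E (st_s P ++ u) (st_t P k ++ u) /\
    (exists i, pairing (unl (depth k)) i = length (st_s P ++ u) - 1) /\
    st_s P' = st_s P ++ u ++ [false] /\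
    (forall j, k < j <= 2 * k ->
      st_t P' j = st_t P j ++ u ++ [false] /\ st_U P' j = st_U P j) /\
    (forall b, st_t P' (child k b) = st_t P k ++ u ++ [b] /\
      (forall y, st_U P' (child k b) y -> st_U P k y) /\
      (forall y z, st_U P' (child k b) y -> st_U P' (child k b) z ->
        d y z <= / INR (S k))%R).

Lemma stage_step k P : stage_inv k P -> exists P', stage_inv (S k) P' /\ stage_next k P P'.
Proof.
  intro HP. destruct (HP k ltac:(lia)) as [Hnode HU].
  assert (Hpos : (0 < / INR (S k))%R) by (apply Rinv_0_lt_compat, lt_0_INR; lia).
  destruct (nonmeager_shrink d q _ _ _ Hsym Htri Hq Hpos HU) as [V [x [HVU [HVd HV]]]].
  destruct Hnode as [s' [t' [w [HE' [Hs Ht]]]]].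
  destruct HE as [_ [_ [Hb _]]].
  destruct (Hb (unl (depth k)) (length s') (w ++ x) s' t' HE' eq_refl) as [v [HEv [i Hi]]].
  (* First [x] makes the piece small, then [v] reaches [E]; the piece stays nonmeager below any
     further extension. *)
  pose (u := x ++ v).
  assert (Hsu : st_s P ++ u = s' ++ false :: (w ++ x) ++ v)
    by (unfold u; rewrite Hs, <- !app_assoc; reflexivity).
  assert (Htu : st_t P k ++ u = t' ++ true :: (w ++ x) ++ v)
    by (unfold u; rewrite Ht, <- !app_assoc; reflexivity).
  rewrite <- Hsu, <- Htu in HEv. rewrite <- Htu, <- (test_length _ _ HEv) in Hi.
  pose (P' := {| st_s := st_s P ++ u ++ [false];
    st_t := fun j => if Nat.leb j (2 * k) then st_t P j ++ u ++ [false]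
                     else st_t P k ++ u ++ [Nat.eqb j (2 * k + 2)];
    st_U := fun j => if Nat.leb j (2 * k) then st_U P j else V |}).
  assert (Hchild : forall b, st_t P' (child k b) = st_t P k ++ u ++ [b] /\
    st_U P' (child k b) = V).
  { intro b. unfold P', child. cbn [st_t st_U].
    destruct (Nat.leb_spec (2 * k + (if b then 2 else 1)) (2 * k)); [destruct b; lia|].
    split; [|reflexivity]. do 3 f_equal. destruct b; [apply Nat.eqb_refl|].
    apply Nat.eqb_neq. lia. }
  assert (Hold : forall j, j <= 2 * k ->
    st_t P' j = st_t P j ++ u ++ [false] /\ st_U P' j = st_U P j).
  { intros j Hj. unfold P'. cbn [st_t st_U].
    now destruct (Nat.leb_spec j (2 * k)); [|lia]. }
  exists P'. split.
  - intros j Hj. destruct (Nat.le_gt_cases j (2 * k)) as [Hj'|Hj'].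
    + destruct (Hold j Hj') as [-> ->]. destruct (HP j ltac:(lia)) as [H1 H2]. split.
      * now apply tree_node_app.
      * intro y. rewrite <- app_assoc. apply H2.
    + assert (Hc : exists b, j = child k b).
      { unfold child. destruct (Nat.eq_dec j (2 * k + 2)); [exists true|exists false]; lia. }
      destruct Hc as [b ->]. destruct (Hchild b) as [-> ->]. split.
      * destruct b.
        -- exists (st_s P ++ u), (st_t P k ++ u), []. split; [assumption|].
           cbn [st_s]. now rewrite <- !app_assoc.
        -- apply tree_node_app. now exists s', t', w.
      * intro y. unfold u. rewrite <- !app_assoc, app_assoc. apply HV.
  - exists u. split; [assumption|split; [eauto|split; [reflexivity|split]]].
    + intros j Hj. apply Hold. lia.
    + intro b. destruct (Hchild b) as [-> ->]. auto.
Qed.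

Lemma tree_embedding : exists (a0 : cantor) (f : cantor -> cantor),
  (forall a, body E (a0, f a)) /\
  (forall a m, (exists j, shift (symdiff a0 (f a)) (pairing m j) = true) <->
    exists j, a (pairing m j) = true) /\
  (forall a e, (0 < e)%R -> exists N, forall b, (forall i, i < N -> b i = a i) ->
    (d (f a) (f b) < e)%R).
Proof.
  (* The root pair of [E] forces a difference at place [0] on every branch; the shift discards
     it. *)
  pose (P0 := {| st_s := [false]; st_t := fun _ => [true]; st_U := fun _ _ => True |}).
  destruct (dependent_choice_inv stage_inv stage_next P0) as [P [HP0 HP]].
  { intros j Hj. split.
    - exists [], [], []. split; [apply test_nil|split; reflexivity].
    - intros x Hx. apply (baire ([true] ++ x)). apply meager_subset with (2 := Hx).
      intros y Hy. split; [exact I|exact Hy]. }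
  { apply stage_step. }
  assert (Hinv := fun k => proj1 (HP k)).
  assert (Hnext := fun k => proj2 (HP k)). clear HP.
  apply functional_choice in Hnext as [u Hu].
  pose (s k := st_s (P k)).
  pose (t a k := st_t (P k) (alive a k)).
  pose (U a k := st_U (P k) (alive a k)).
  pose (bit a k := if Nat.eqb (alive a k) k then a (depth k) else false).
  assert (Hs : forall k, s (S k) = s k ++ u k ++ [false]) by (intro k; apply Hu).
  assert (HtU : forall a k, t a (S k) = t a k ++ u k ++ [bit a k] /\
    (forall y, U a (S k) y -> U a k y)).
  { intros a k. unfold t, U, bit. simpl. pose proof (alive_bounds a k).
    destruct (Hu k) as [_ [_ [_ [Hold Hnew]]]].
    destruct (Nat.eqb_spec (alive a k) k) as [->|Hk].
    - split; apply Hnew.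
    - destruct (Hold (alive a k)) as [H1 H2]; [lia|]. split; [assumption|].
      now rewrite H2. }
  assert (Ht := fun a k => proj1 (HtU a k)). assert (HU := fun a k => proj2 (HtU a k)).
  clear HtU.
  assert (HUd : forall a k, alive a k = k -> forall y z, U a (S k) y -> U a (S k) z ->
    (d y z <= / INR (S k))%R).
  { intros a k Hk. unfold U. simpl. rewrite Hk, Nat.eqb_refl. apply Hu. }
  assert (HU' : forall a k i y, U a (k + i) y -> U a k y).
  { intros a k i. induction i as [|i IH]; intro y.
    - now rewrite Nat.add_0_r.
    - rewrite Nat.add_succ_r. auto. }
  assert (Hst : forall a k, tree_node E (s k) (t a k) /\ nonmeager_in (t a k) (U a k))
    by (intros a k; apply Hinv, alive_bounds).
  assert (Hlen : forall a k, length (t a k) = length (s k))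
    by (intros a k; symmetry; apply tree_node_length, Hst).
  pose (a0 := word_lim s). pose (f a := word_lim (t a)).
  assert (Ha0 : forall k, k <= length (s k) /\ cyl (s k) a0)
    by (apply word_lim_spec; eauto).
  assert (Hf : forall a k, k <= length (t a k) /\ cyl (t a k) (f a))
    by (intro a; apply word_lim_spec; eauto).
  exists a0, f. split; [|split].
  - intros a n. simpl.
    rewrite (cyl_firstn (s n)), (cyl_firstn (t a n)) by (apply Ha0 || apply Hf).
    apply in_tree_firstn. right. apply Hst.
  - intros a m. split.
    + intros [j Hj].
      (* Beyond place [0], every difference comes from a stage that split the branch of [a] at a bit
         equal to one. *)
      assert (K : forall k i, i < length (s k) -> nth i (s k) false <> nth i (t a k) false ->
        i = 0 \/ exists k', alive a k' = k' /\ a (depth k') = true /\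
          i = length (s k' ++ u k')).
      { induction k as [|k IH]; intros i Hi Hne.
        - left. unfold s in Hi. rewrite HP0 in Hi. simpl in Hi. lia.
        - rewrite Hs, Ht in Hne. rewrite Hs in Hi. rewrite !app_assoc in *.
          rewrite length_app in Hi. simpl in Hi.
          destruct (Nat.lt_ge_cases i (length (s k))) as [H1|H1].
          + apply IH; auto. now rewrite !app_nth1 in Hne
              by (rewrite ?length_app, ?Hlen; lia).
          + destruct (Nat.eq_dec i (length (s k ++ u k))) as [H2|H2].
            * right. exists k. rewrite H2 in Hne at 1. rewrite nth_middle in Hne.
              rewrite app_nth2 in Hne by (rewrite H2, !length_app, Hlen; lia).
              replace (i - length (t a k ++ u k)) with 0 in Hne
                by (rewrite H2, !length_app, Hlen; lia).
              simpl in Hne. unfold bit in Hne.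
              destruct (Nat.eqb_spec (alive a k) k) as [H3|]; [|congruence].
              split; [assumption|split; [|assumption]].
              now destruct (a (depth k)).
            * destruct Hne. rewrite length_app in *.
              rewrite !(app_nth1 (_ ++ u k)) by (rewrite length_app, ?Hlen; lia).
              rewrite !app_nth2 by (rewrite ?Hlen; lia). now rewrite Hlen. }
      set (i := S (pairing m j)).
      assert (Hi : i < length (s (S i))) by apply Ha0.
      destruct (K (S i) i Hi) as [H|[k [Hk [Hak Hik]]]]; [|discriminate|].
      * intro H. unfold shift, symdiff in Hj. fold i in Hj.
        rewrite (proj2 (Ha0 (S i)) i Hi), (proj2 (Hf a (S i)) i), H in Hj
          by (now rewrite Hlen).
        now rewrite Bool.eqb_reflx in Hj.
      * destruct (Hu k) as [_ [[j' Hj'] _]]. fold (s k) in Hj'. rewrite <- Hik in Hj'.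
        unfold i in Hj'. simpl in Hj'. rewrite Nat.sub_0_r in Hj'.
        apply (f_equal unl) in Hj'. rewrite !unl_pairing in Hj'.
        exists (unr (depth k)). now rewrite <- Hj', pairing_un.
    + intros [j Hj]. destruct (alive_hits a (pairing m j)) as [k [_ [Hk Hd]]].
      destruct (Hu k) as [_ [[j' Hj'] _]]. rewrite Hd, unl_pairing in Hj'.
      exists j'. fold (s k) in Hj'. set (i := length (s k ++ u k)) in *.
      assert (Hi : S (pairing m j') = i).
      { rewrite Hj'. unfold i. rewrite length_app.
        pose proof (tree_node_length _ _ (proj1 (Hst a k))). lia. }
      unfold shift. rewrite Hi. unfold symdiff.
      rewrite (proj2 (Ha0 (S k)) i), (proj2 (Hf a (S k)) i), Hs, Ht
        by (rewrite ?Hlen, Hs; unfold i; rewrite !length_app; simpl; lia).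
      rewrite !app_assoc. unfold i at 1. rewrite nth_middle.
      replace i with (length (t a k ++ u k))
        by (unfold i; now rewrite !length_app, Hlen).
      rewrite nth_middle. unfold bit. now rewrite Hk, Nat.eqb_refl, Hd, Hj.
  - assert (Hpt : forall a k, exists y, U a k y /\ cyl (t a k) y).
    { intros a k. apply nonmeager_point. destruct (Hst a k) as [_ H].
      specialize (H []). now rewrite app_nil_r in H. }
    assert (Hsmall : forall a e, (0 < e)%R -> exists k, forall y z,
      U a k y -> U a k z -> (d y z < e)%R).
    { intros a e He. destruct (INR_unbounded (/ e)) as [n Hn].
      destruct (alive_hits a n) as [k [Hnk [Hk _]]]. exists (S k).
      intros y z Hy Hz. apply Rle_lt_trans with (1 := HUd a k Hk y z Hy Hz).
      rewrite <- (Rinv_inv e). apply Rinv_lt_contravar.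
      - apply Rmult_lt_0_compat; [now apply Rinv_0_lt_compat|]. apply lt_0_INR. lia.
      - apply Rlt_le_trans with (1 := Hn). apply le_INR. lia. }
    (* The limit [f a] need not belong to [U a k], only to its [d]-closure; hence the weak
       inequality. *)
    assert (Hlim : forall a k e, (forall y z, U a k y -> U a k z -> d y z < e)%R ->
      forall y, U a k y -> (d y (f a) <= e)%R).
    { intros a k e Hke y Hy. destruct (functional_choice _ (Hpt a)) as [Y HY].
      destruct (Hcomplete Y) as [l Hl].
      { intros e' He'. destruct (Hsmall a e' He') as [N HN]. exists N.
        intros n m Hn Hm. apply HN.
        - apply (HU' a N (n - N)). replace (N + (n - N)) with n by lia. apply HY.
        - apply (HU' a N (m - N)). replace (N + (m - N)) with m by lia. apply HY. }
      (* The points [Y n] follow the words [t a n], so they converge to [f a] coordinatewise; [d]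
         refines the usual topology, so their [d]-limit is the same point. *)
      assert (Hlf : l = f a).
      { apply functional_extensionality; intro i.
        assert (Hop : cantor_open (fun y => y i = l i)).
        { apply clopen_open. exists (S i). intros x x' H <-. symmetry. apply H. lia. }
        destruct (Hfiner _ Hop l eq_refl) as [r [Hr Hball]].
        destruct (Hl r Hr) as [N HN].
        assert (Hmax : N <= N + S i /\ i < length (t a (N + S i))).
        { split; [lia|]. pose proof (proj1 (Hf a (N + S i))). lia. }
        destruct Hmax as [H1 H2].
        rewrite <- (Hball (Y (N + S i))) by (rewrite Hsym; now apply HN).
        rewrite (proj2 (HY (N + S i)) i H2). symmetry. now apply Hf. }
      rewrite <- Hlf. apply le_epsilon. intros e' He'. destruct (Hl e' He') as [N HN].
      specialize (HN (k + N) ltac:(lia)).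
      assert (HY' : U a k (Y (k + N))) by (apply (HU' a k N), HY).
      specialize (Hke y _ Hy HY'). specialize (Htri y (Y (k + N)) l). lra. }
    (* Sequences that agree below [k] share the set at stage [k]. Each image is within [e / 3] of a
       common point [y], and [2e / 3] is strictly below [e]. *)
    intros a e He. destruct (Hsmall a (e / 3)%R) as [k Hk]; [lra|].
    exists k. intros b Hb. destruct (Hpt a k) as [y [Hy _]].
    assert (Hab : U b k = U a k) by (unfold U; now rewrite (alive_local a b)).
    pose proof (Hlim a k _ Hk y Hy) as H1.
    rewrite <- Hab in Hk, Hy. pose proof (Hlim b k _ Hk y Hy) as H2.
    specialize (Htri (f a) y (f b)). rewrite (Hsym (f a) y) in Htri. lra.
Qed.

End Test.

(** * Arbitrary finer topologies, the upper bound and the conclusion *)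

Lemma tree_embedding_polish E tau : is_test E -> finer_polish tau ->
  exists (a0 : cantor) (f : cantor -> cantor),
    (forall V, tau V -> cantor_open (fun a => V (f a))) /\
    (forall a, body E (a0, f a)) /\
    (forall a m, (exists j, shift (symdiff a0 (f a)) (pairing m j) = true) <->
      exists j, a (pairing m j) = true).
Proof.
  intros HE [Hfiner [d [_ [_ [Hsym [Htri [Hop [Hcomp [q Hq]]]]]]]]].
  destruct (tree_embedding E HE d q) as [a0 [f [Hbody [Hcol Hcont]]]]; auto.
  { intros U HU. now apply Hop, Hfiner. }
  exists a0, f. split; [|now split].
  intros V HV a Ha. destruct (proj1 (Hop V) HV (f a) Ha) as [e [He HeV]].
  destruct (Hcont a e He) as [N HN]. exists N. auto.
Qed.

(** The closure properties of the classes are established on the Cantor space; this continuous map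
    carries them to the product. *)
Definition interleave (z : cantor * cantor) : cantor := fun n =>
  if Nat.even n then fst z (Nat.div2 n) else snd z (Nat.div2 n).

Lemma continuous_interleave U : cantor_open U ->
  prod_open cantor_open cantor_open (fun z => U (interleave z)).
Proof.
  intros HU x y Hxy. destruct (HU _ Hxy) as [n Hn].
  exists (fun x' => forall i, i < n -> x' i = x i), (fun y' => forall i, i < n -> y' i = y i).
  assert (Hop : forall x : cantor, cantor_open (fun x' => forall i, i < n -> x' i = x i)).
  { intros v w Hw. exists n. intros w' Hw' i Hi. rewrite Hw', Hw; auto. }
  repeat split; auto. intros x' y' Hx' Hy'. apply Hn. intros i Hi. unfold interleave.
  pose proof (Nat.div2_decr i i) as Hi2.
  simpl. destruct (Nat.even i); [apply Hx'|apply Hy']; lia.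
Qed.

Lemma interleave_fst z : (fun n => interleave z (2 * n)) = fst z.
Proof.
  apply functional_extensionality; intro n. unfold interleave.
  now rewrite Nat.even_mul, Nat.div2_double.
Qed.

Lemma interleave_snd z : (fun n => interleave z (S (2 * n))) = snd z.
Proof.
  apply functional_extensionality; intro n. unfold interleave.
  rewrite Nat.even_succ, Nat.odd_mul. simpl (Nat.odd 2). simpl andb.
  now rewrite Nat.div2_succ_double.
Qed.

Theorem theorem3p5 (E : list bool -> list bool -> Prop) (sel : ord -> nat -> ord)
  (R : ord -> cantor -> cantor) (xi : ord) :
  is_test E -> good_sel sel -> rho_family sel R ->
  Pi0 (prod_open cantor_open cantor_open) xi (fun z => body E z /\ ~ S_set E R xi z) /\
  ~ pot_Sigma0 xi (fun z => body E z /\ ~ S_set E R xi z) /\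
  ~ pot_Pi0 xi (S_set E R xi).
Proof.
  intros HE Hsel HR.
  assert (Hpi : Pi0 (prod_open cantor_open cantor_open) xi
    (fun z => body E z /\ ~ S_set E R xi z)).
  { pose (l (x : cantor) n := x (2 * n)). pose (r (x : cantor) n := x (S (2 * n))).
    assert (K : Sig xi (fun x => (exists n, ~ in_tree E (pref (l x) n) (pref (r x) n)) \/
      ~ H_set R xi (shift (symdiff (l x) (r x))))).
    { apply Sigma0_or.
      - apply Sigma0_union. intro n. apply clopen_Sigma0. exists (S (2 * n)).
        intros x y Hxy. unfold l, r.
        enough (K : pref (fun i => x (2 * i)) n = pref (fun i => y (2 * i)) n /\
          pref (fun i => x (S (2 * i))) n = pref (fun i => y (S (2 * i))) n)
          by (destruct K as [-> ->]; auto).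
        unfold pref. split; apply map_ext_in; intros i Hi; apply in_seq in Hi;
          apply Hxy; lia.
      - apply (Sigma0_preimage cantor_open cantor_open
          (fun x => shift (symdiff (l x) (r x))) xi (fun y => ~ H_set R xi y)).
        + intros U HU x Hx. destruct (HU _ Hx) as [n Hn]. exists (S (S (2 * n))).
          intros y Hy. apply Hn. intros i Hi. unfold shift, symdiff, l, r.
          rewrite !Hy by lia. reflexivity.
        + now apply H_Pi0 with sel. }
    apply (Sigma0_preimage (prod_open cantor_open cantor_open) cantor_open interleave)
      in K; [|apply continuous_interleave].
    apply Sigma0_ext with (2 := K). intro z. unfold l, r.
    rewrite interleave_fst, interleave_snd. unfold S_set.
    split.
    - intros [[n Hn]|Hz] [Hb HS]; [now apply Hn, Hb|tauto].
    - intro Hz. destruct (classic (body E z)) as [Hb|Hb].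
      + right. intro Hz'. apply Hz. tauto.
      + left. now apply not_all_ex_not in Hb. }
  (* on a vertical section only the topology of the second factor matters *)
  assert (Hred : forall sig tau A, finer_polish tau ->
    Sigma0 (prod_open sig tau) xi A ->
    exists a0 f, Sig xi (fun a => A (a0, f a)) /\ (forall a, body E (a0, f a)) /\
      forall a, H_set R xi (shift (symdiff a0 (f a))) <-> H_set R xi a).
  { intros sig tau A Htau HA.
    destruct (tree_embedding_polish E tau HE Htau) as [a0 [f [Hf [Hb Hcol]]]].
    exists a0, f. split; [|split; [assumption|]].
    - apply Sigma0_preimage with (2 := HA). intros W HW a Ha.
      destruct (HW _ _ Ha) as [U [V [_ [HV [HU [HVa HUV]]]]]].
      destruct (Hf V HV a HVa) as [n Hn]. exists n. auto.
    - intro a. apply H_set_columns with sel; auto. }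
  split; [assumption|split].
  (* All points [(a0, f a)] are in the body, so this set and the complement of [S_set] both pull
     back to [H_set]; one lower bound refutes both claims. *)
  - intros [sig [tau [_ [Htau HA]]]].
    destruct (Hred sig tau _ Htau HA) as [a0 [f [HS [Hb HH]]]].
    apply (H_not_Sigma0 sel R Hsel HR xi). apply Sigma0_ext with (2 := HS).
    intro a. specialize (Hb a). specialize (HH a). unfold S_set. simpl. tauto.
  - intros [sig [tau [_ [Htau HA]]]].
    destruct (Hred sig tau _ Htau HA) as [a0 [f [HS [Hb HH]]]].
    apply (H_not_Sigma0 sel R Hsel HR xi). apply Sigma0_ext with (2 := HS).
    intro a. specialize (Hb a). specialize (HH a). unfold S_set. simpl. tauto.
Qed.
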